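(* Let $\alpha,\beta,\omega,\rho\in\mathbb{C}$ with $\mathrm{Re}(\alpha)>0$ and $\mathrm{Re}(\beta)>0$. Then for any $L^1$ function $f$ and any $\mu,\nu\in\mathbb{C}$ with $\mathrm{Re}(\nu\beta)>0$, $$\left(\mathcal{E}_{\alpha,\beta;c+}^{\omega,\rho}\right)^{\mu}\left(\mathcal{E}_{\alpha,\beta;c+}^{\omega,\rho}\right)^{\nu}f(x)=\left(\mathcal{E}_{\alpha,\beta;c+}^{\omega,\rho}\right)^{\mu+\nu}f(x).$$
   Context: The Prabhakar fractional integral is $\mathcal{E}_{\alpha,\beta;c+}^{\omega,\rho}f(x)=\int_c^x (x-t)^{\beta-1}E_{\alpha,\beta}^{\rho}[\omega(x-t)^{\alpha}]f(t)\,\mathrm{d}t$ for $\mathrm{Re}(\alpha),\mathrm{Re}(\beta)>0$, where $E_{\alpha,\beta}^{\rho}(z)=\sum_{n\ge0}\frac{(\rho)_n z^n}{\Gamma(\alpha n+\beta)n!}$ and $(\rho)_n=\Gamma(\rho+n)/\Gamma(\rho)$ is the Pochhammer symbol. For $\nu\in\mathbb{C}$, the $\nu$th iteration of the Prabhakar operator is defined by $$\left(\mathcal{E}_{\alpha,\beta;c+}^{\omega,\rho}\right)^{\nu}f(x)=\frac{\mathrm{d}^m}{\mathrm{d}x^m}\mathcal{E}_{\alpha,m+\nu\beta;c+}^{\omega,\nu\rho}f(x),\qquad m=\max\big(0,\lfloor\mathrm{Re}(-\nu\beta)\rfloor+1\big);$$ in particular, when $\mathrm{Re}(\nu\beta)>0$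 this is $\mathcal{E}_{\alpha,\nu\beta;c+}^{\omega,\nu\rho}f$.
   Formalization: For f merely L^1 the derivative d^m/dx^m need not exist classically, so it is taken in the sense of distributions on (c,d), d>c arbitrary and f integrable on (c,d); the identity is equality of distributions, i.e. almost everywhere when both sides are functions. *)

(* Defs.v *)
From mathcomp Require Import all_boot all_order all_algebra.
From mathcomp Require Import all_classical all_reals all_analysis.
From mathcomp Require Import complex.
Set Implicit Arguments. Unset Strict Implicit. Unset Printing Implicit Defensive.
Import Order.TTheory GRing.Theory Num.Theory.
Import numFieldNormedType.Exports.
Local Open Scope ring_scope.
Local Open Scope classical_set_scope.
Local Open Scope complex_scope.

Section Prabhakar.
Variable R : realType.
Local Notation C := R[i].
Local Notation mu := (@lebesgue_measure R).

Definition cexp (z : C) : C :=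
  (expR (complex.Re z) * cos (complex.Im z)) +i* (expR (complex.Re z) * sin (complex.Im z)).

Definition cpow (t : R) (z : C) : C := cexp ((ln t)%:C * z).

Definition cint (A : set R) (h : R -> C) : C :=
  (Rintegral mu A (fun t => complex.Re (h t))) +i* (Rintegral mu A (fun t => complex.Im (h t))).

Definition cintegrable (A : set R) (h : R -> C) : Prop :=
  mu.-integrable A (fun t => (complex.Re (h t))%:E) /\
  mu.-integrable A (fun t => (complex.Im (h t))%:E).

(* Euler Gamma function, Gamma(z) = int_0^oo t^(z-1) e^(-t) dt  (used only for Re z > 0) *)
Definition Gamma (z : C) : C :=
  cint `]0, +oo[ (fun t => cpow t (z - 1) * cexp (- (t%:C))).

Definition pochhammer (rho : C) (n : nat) : C := \prod_(k < n) (rho + k%:R).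

Definition ML_partial (al be rho z : C) (N : nat) : C :=
  \sum_(n < N) (pochhammer rho n * z ^+ n / (Gamma (al * n%:R + be) * (n`!)%:R)).

Definition ML (al be rho z : C) : C :=
  (limn (fun N => complex.Re (ML_partial al be rho z N))) +i*
  (limn (fun N => complex.Im (ML_partial al be rho z N))).

Definition prab (al be om rho : C) (c : R) (f : R -> C) (x : R) : C :=
  cint `]c, x[ (fun t => cpow (x - t) (be - 1) * ML al be rho (om * cpow (x - t) al) * f t).

Definition iter_order (z : C) : nat :=
  absz (Num.max (0 : int) (Num.floor (complex.Re (- z)) + 1)%R).

Definition test_fun (c d : R) (phi : R -> R) : Prop :=
  (forall (n : nat) (x : R), derivable (derive1n n phi) x 1) /\
  exists a b : R, [/\ c < a, a < b, b < d &
     forall x, x < a \/ b < x -> phi x = 0].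

(* The nu-th iterated Prabhakar operator
     (E^{om,rho}_{al,be;c+})^nu g = d^m/dx^m E^{om, nu rho}_{al, m + nu be; c+} g,
   m = max(0, floor(Re(-nu be)) + 1), with the derivative d^m/dx^m taken in the
   sense of distributions on ]c, d[: its action on a test function phi is
     (-1)^m int_c^d (E^{om, nu rho}_{al, m + nu be; c+} g)(x) phi^(m)(x) dx. *)
Definition prab_iter (al be om rho : C) (c d : R) (nu : C) (g : R -> C)
    (phi : R -> R) : C :=
  let m := iter_order (nu * be) in
  (- 1) ^+ m * cint `]c, d[
     (fun x => prab al (m%:R + nu * be) om (nu * rho) c g x * (derive1n m phi x)%:C).

End Prabhakar.

(* Main.v *)
Require Import Defs.
From mathcomp Require Import all_boot all_order all_algebra.
From mathcomp Require Import all_classical all_reals all_analysis.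
From mathcomp Require Import measurable_realfun complex.
From mathcomp Require Import ring lra.
Set Implicit Arguments. Unset Strict Implicit. Unset Printing Implicit Defensive.
Import Order.TTheory GRing.Theory Num.Theory.
Import numFieldNormedType.Exports.
Local Open Scope ring_scope.
Local Open Scope classical_set_scope.
Local Open Scope complex_scope.

(** Let K_{b,r} be the kernel s^(b-1) E^r_{al,b}(om s^al) on ]0, +oo[, extended by 0, so
    that every Prabhakar integral is a convolution with some K_{b,r}.  The heart of the
    matter is K_{b,r} * K_{b',r'} = K_{b+b',r+r'}: expanding both kernels, the Beta
    integral turns the products of powers into powers, and the coefficients combine by
    the Chu-Vandermonde identity.  The interchange of sum and integral needs the decay of
    1/Gamma(al n + b), which comes from the Beta integral as well, since
      Gamma(al) / Gamma(al (n+1) + b) = B(al n + b, al) / Gamma(al n + b)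
    and B(al n + b, al) tends to 0.  Gamma has no zero in the right half-plane, because
    Gamma(z) = 0 would give Gamma(z / 2^k) = 0, hence Gamma(1 + z / 2^k) = 0 for all k,
    against Gamma(1) = 1.  Associativity of the convolution of integrable functions then
    gives the semigroup law almost everywhere.  When the two sides carry a different
    number of derivatives, they are moved from the test function one by one: integration
    over ]c, x[ is convolution with K_{1,0} = 1. *)

(** Both sides are functionals of [phi], integrals of an L^1 function against a derivative of [phi],
    so equality almost everywhere of the convolutions is enough. Since Re(nu * be) > 0, the order
    attached to mu is at least that attached to mu + nu, and only the surplus derivatives have to be
    moved.

    Convolutions of L^1 functions have a meaning almost everywhere only, whereas the kernel identity
    is obtained at every point. The link is homogeneity: the Beta integrand, integrable at one
    positive abscissa by Fubini for the Gamma integrands, is integrable at all of them by scaling,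
    and it then dominates the convolutions of partial sums.

    Multiplying two partial sums of length N gives a square of terms, while Chu-Vandermonde sums
    along diagonals. The excess of the square over the triangle is controlled by the series of
    moduli, whose diagonals are summed by the same identity with |r1| + |r2| in place of r1 + r2.

    Zeros of Gamma must be excluded because the coefficients divide by Gamma and the inverse of 0 is
    0: at a zero, a term of the series would silently disappear and the Beta integral could no
    longer be solved for. *)

Local Notation Re := complex.Re.
Local Notation Im := complex.Im.
Local Notation nc := Normc.normc.

(** * Real and imaginary parts, modulus *)

Section ComplexAlgebra.
Variable R : realType.
Local Notation C := R[i].
Implicit Types z w : C.

Lemma ReD z w : Re (z + w) = Re z + Re w. Proof. by case: z w => [? ?] []. Qed.
Lemma ImD z w : Im (z + w) = Im z + Im w. Proof. by case: z w => [? ?] []. Qed.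
Lemma ReN z : Re (- z) = - Re z. Proof. by case: z. Qed.
Lemma ImN z : Im (- z) = - Im z. Proof. by case: z. Qed.
Lemma ReB z w : Re (z - w) = Re z - Re w. Proof. by rewrite ReD ReN. Qed.
Lemma ImB z w : Im (z - w) = Im z - Im w. Proof. by rewrite ImD ImN. Qed.
Lemma ReM z w : Re (z * w) = Re z * Re w - Im z * Im w.
Proof. by case: z w => [? ?] []. Qed.
Lemma ImM z w : Im (z * w) = Re z * Im w + Im z * Re w.
Proof. by case: z w => [? ?] []. Qed.
Lemma ReMreal (a : R) z : Re (a%:C * z) = a * Re z.
Proof. by rewrite ReM /= mul0r subr0. Qed.
Lemma ImMreal (a : R) z : Im (a%:C * z) = a * Im z.
Proof. by rewrite ImM /= mul0r addr0. Qed.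
Lemma Re_nat n : Re (n%:R : C) = n%:R.
Proof. by elim: n => [//|n ih]; rewrite -natr1 ReD ih /= natr1. Qed.
Lemma Im_nat n : Im (n%:R : C) = 0.
Proof. by elim: n => [//|n ih]; rewrite -natr1 ImD ih /= addr0. Qed.
Lemma Re_sum I (r : seq I) (P : pred I) (F : I -> C) :
  Re (\sum_(i <- r | P i) F i) = \sum_(i <- r | P i) Re (F i).
Proof. by elim/big_rec2: _ => [//|i x y _ <-]; rewrite ReD. Qed.
Lemma Im_sum I (r : seq I) (P : pred I) (F : I -> C) :
  Im (\sum_(i <- r | P i) F i) = \sum_(i <- r | P i) Im (F i).
Proof. by elim/big_rec2: _ => [//|i x y _ <-]; rewrite ImD. Qed.
Lemma complex_eq z w : Re z = Re w -> Im z = Im w -> z = w.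
Proof. by case: z w => [? ?] [? ?] /= -> ->. Qed.

Lemma normc_ge0 z : 0 <= nc z.
Proof. by case: z => a b; rewrite sqrtr_ge0. Qed.

Lemma normc_gt0 z : z != 0 -> 0 < nc z.
Proof.
move=> z0; rewrite lt_neqAle normc_ge0 andbT eq_sym.
by apply: contra z0 => /eqP/Normc.eq0_normc ->.
Qed.

Lemma normcE2 z : nc z = Num.sqrt (Re z ^+ 2 + Im z ^+ 2).
Proof. by case: z. Qed.

Lemma ler_Re_normc z : `|Re z| <= nc z.
Proof.
by rewrite normcE2 -sqrtr_sqr ler_sqrt ?lerDl ?sqr_ge0// addr_ge0 ?sqr_ge0.
Qed.

Lemma ler_Im_normc z : `|Im z| <= nc z.
Proof.
by rewrite normcE2 -sqrtr_sqr ler_sqrt ?lerDr ?sqr_ge0// addr_ge0 ?sqr_ge0.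
Qed.

Lemma normc_le_ReIm z : nc z <= `|Re z| + `|Im z|.
Proof.
rewrite -(@ler_pXn2r _ 2)// ?nnegrE ?normc_ge0 ?addr_ge0//.
rewrite normcE2 sqr_sqrtr ?addr_ge0 ?sqr_ge0//.
rewrite sqrrD !real_normK ?num_real// addrAC lerDl.
by rewrite mulrn_wge0 ?mulr_ge0.
Qed.

Lemma normcX z n : nc (z ^+ n) = nc z ^+ n.
Proof.
elim: n => [|n ih]; first by rewrite !expr0; apply: Normc.normc1.
by rewrite !exprS Normc.normcM ih.
Qed.

Lemma normc_real (x : R) : nc x%:C = `|x|.
Proof. by rewrite normcE2/= expr0n addr0 sqrtr_sqr. Qed.

Lemma normc_nat n : nc (n%:R : C) = n%:R.
Proof. by rewrite normcE2 Re_nat Im_nat expr0n addr0 sqrtr_sqr ger0_norm. Qed.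

Lemma normc_sum I (r : seq I) (P : pred I) (F : I -> C) :
  nc (\sum_(i <- r | P i) F i) <= \sum_(i <- r | P i) nc (F i).
Proof.
elim/big_rec2: _ => [|i x y _ ih]; first by rewrite Normc.normc0.
by apply: le_trans (le_normcD _ _) _; rewrite lerD2l.
Qed.

End ComplexAlgebra.

(** * Measurable and integrable complex functions *)

Section MeasurableComplex.
Context (d : measure_display) (T : measurableType d) (R : realType).
Local Notation C := R[i].
Implicit Types g h : T -> C.

Definition cmeasurable h :=
  measurable_fun setT (fun t => Re (h t)) /\ measurable_fun setT (fun t => Im (h t)).

Lemma cmeasurableD g h : cmeasurable g -> cmeasurable h ->
  cmeasurable (fun t => g t + h t).
Proof.
move=> [g1 g2] [h1 h2]; split.
  by under eq_fun do rewrite ReD; exact: measurable_funD.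
by under eq_fun do rewrite ImD; exact: measurable_funD.
Qed.

Lemma cmeasurableM g h : cmeasurable g -> cmeasurable h ->
  cmeasurable (fun t => g t * h t).
Proof.
move=> [g1 g2] [h1 h2]; split.
  under eq_fun do rewrite ReM.
  by apply: measurable_funB; exact: measurable_funM.
under eq_fun do rewrite ImM.
by apply: measurable_funD; exact: measurable_funM.
Qed.

Lemma cmeasurable_cst (k : C) : cmeasurable (fun=> k).
Proof. by split; exact: measurable_cst. Qed.

Lemma cmeasurable_real (f : T -> R) : measurable_fun setT f ->
  cmeasurable (fun t => (f t)%:C).
Proof. by move=> mf; split => //=; exact: measurable_cst. Qed.

Lemma cmeasurable_sum n (F : nat -> T -> C) :
  (forall i, cmeasurable (F i)) -> cmeasurable (fun t => \sum_(i < n) F i t).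
Proof.
move=> mF; elim: n => [|n ih].
  under eq_fun do rewrite big_ord0; exact: cmeasurable_cst.
by under eq_fun do rewrite big_ord_recr; exact: cmeasurableD.
Qed.

Lemma cmeasurable_if (b : T -> bool) g h : measurable_fun setT b ->
  cmeasurable g -> cmeasurable h -> cmeasurable (fun t => if b t then g t else h t).
Proof.
move=> mb [g1 g2] [h1 h2]; split.
  have -> : (fun t => Re (if b t then g t else h t)) =
            (fun t => if b t then Re (g t) else Re (h t)).
    by apply/funext => t; case: (b t).
  exact: measurable_fun_ifT.
have -> : (fun t => Im (if b t then g t else h t)) =
          (fun t => if b t then Im (g t) else Im (h t)).
  by apply/funext => t; case: (b t).
exact: measurable_fun_ifT.
Qed.

Lemma measurable_normc h : cmeasurable h -> measurable_fun setT (fun t => nc (h t)).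
Proof.
move=> [h1 h2]; under eq_fun do rewrite normcE2.
apply: (measurableT_comp (continuous_measurable_fun (@sqrt_continuous R))).
by apply: measurable_funD; exact: measurable_funX.
Qed.

Lemma cmeasurable_cvg (F : nat -> T -> C) h : (forall n, cmeasurable (F n)) ->
  (forall t, (fun n => Re (F n t)) @ \oo --> Re (h t)) ->
  (forall t, (fun n => Im (F n t)) @ \oo --> Im (h t)) -> cmeasurable h.
Proof.
move=> mF cR cI; split.
  apply: (measurable_fun_cvg (h := fun n t => Re (F n t))) => //.
  by move=> n; case: (mF n).
apply: (measurable_fun_cvg (h := fun n t => Im (F n t))) => //.
by move=> n; case: (mF n).
Qed.

Variable m : {measure set T -> \bar R}.

Definition cintegr h :=
  m.-integrable setT (fun t => (Re (h t))%:E) /\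
  m.-integrable setT (fun t => (Im (h t))%:E).

Lemma cintegr_meas h : cintegr h -> cmeasurable h.
Proof.
by move=> [/measurable_int h1 /measurable_int h2]; split; exact/measurable_EFinP.
Qed.

Lemma cintegr_le h (g : T -> R) : cmeasurable h ->
  (forall t, nc (h t) <= g t) -> m.-integrable setT (EFin \o g) -> cintegr h.
Proof.
move=> [h1 h2] hg ig; split; apply: le_integrable ig => //.
- exact/measurable_EFinP.
- move=> t _ /=; rewrite lee_fin (le_trans (ler_Re_normc _))// (le_trans (hg t))//.
  exact: ler_norm.
- exact/measurable_EFinP.
- move=> t _ /=; rewrite lee_fin (le_trans (ler_Im_normc _))// (le_trans (hg t))//.
  exact: ler_norm.
Qed.

Lemma integrable_normc h : cintegr h -> m.-integrable setT (fun t => (nc (h t))%:E).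
Proof.
move=> ih; have mh := cintegr_meas ih; case: ih => h1 h2.
have := integrableD measurableT (integrable_abse h1) (integrable_abse h2).
apply: le_integrable => //; first exact/measurable_EFinP/measurable_normc.
move=> t _ /=; rewrite lee_fin ger0_norm ?normc_ge0// (le_trans (normc_le_ReIm _))//.
exact: ler_norm.
Qed.

Lemma cintegrD g h : cintegr g -> cintegr h -> cintegr (fun t => g t + h t).
Proof.
move=> [g1 g2] [h1 h2]; split.
  have := integrableD measurableT g1 h1.
  by apply: eq_integrable => // t _; rewrite ReD.
have := integrableD measurableT g2 h2.
by apply: eq_integrable => // t _; rewrite ImD.
Qed.

Lemma cintegrZ (k : C) h : cintegr h -> cintegr (fun t => k * h t).
Proof.
move=> ih; apply: (cintegr_le (g := fun t => nc k * nc (h t))).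
- by apply: cmeasurableM; [exact: cmeasurable_cst|exact: cintegr_meas].
- by move=> t; rewrite Normc.normcM.
- exact: (integrableZl measurableT (nc k) (integrable_normc ih)).
Qed.

Lemma cintegr0 : cintegr (fun=> 0).
Proof. by split; exact: integrable0. Qed.

End MeasurableComplex.

(** * Affine change of variables for Lebesgue measure *)

Section LebesgueAffine.
Variable R : realType.
Local Notation mu := (@lebesgue_measure R).

Section affine.
Variables (k : {nonneg R}) (a : R).
Hypothesis k0 : 0 < k%:num.
Let phi (x : measurableTypeR R) : measurableTypeR R := k%:num * x + a.

Let mphi : measurable_fun setT phi.
Proof.
apply: measurable_funD; last exact: measurable_cst.
by apply: measurable_funM; [exact: measurable_cst|exact: measurable_id].
Qed.

Let push : {measure set (measurableTypeR R) -> \bar R} :=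
  measure_function_pushforward__canonical__measure_function_Measure mu mphi.

Let scaled_push : {measure set (measurableTypeR R) -> \bar R} := mscale k push.

(** Half-open intervals determine Lebesgue measure. The preimage of []u, v]] under [phi] has length
    (v - u) / k, and the factor k restores v - u. *)
Let lebesgue_affineE (A : set (measurableTypeR R)) : measurable A ->
  mu A = scaled_push A.
Proof.
apply: lebesgue_measure_unique => X /ocitvP[->|[[u v] /= uv ->]].
  by rewrite !measure0.
rewrite /scaled_push /mscale /= /pushforward /=.
have -> : phi @^-1` `]u, v] = `](u - a) / k%:num, (v - a) / k%:num]%classic.
  apply/seteqP; split => x /=; rewrite !in_itv/= /phi.
    by rewrite ltr_pdivrMr// ler_pdivlMr// ltrBlDr lerBrDr mulrC.
  by rewrite ltr_pdivrMr// ler_pdivlMr// ltrBlDr lerBrDr mulrC.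
rewrite !lebesgue_measure_itv/= !lte_fin uv ltr_pM2r ?invr_gt0// ltrD2r uv.
by rewrite -!EFinB -EFinM; congr EFin; field; rewrite gt_eqF.
Qed.

Lemma ge0_integral_affine_aux (f : R -> \bar R) : measurable_fun setT f ->
  (forall x, (0 <= f x)%E) ->
  (\int[mu]_x f x = k%:num%:E * \int[mu]_x f (k%:num * x + a)%R)%E.
Proof.
move=> mf f0.
rewrite (eq_measure_integral scaled_push); last by move=> A mA _; exact: lebesgue_affineE.
rewrite /scaled_push (ge0_integral_mscale push)//.
by rewrite /push ge0_integral_pushforward// preimage_setT.
Qed.

End affine.

Lemma ge0_integral_affine (k a : R) (f : R -> \bar R) : 0 < k ->
  measurable_fun setT f -> (forall x, (0 <= f x)%E) ->
  (\int[mu]_x f x = k%:E * \int[mu]_x f (k * x + a)%R)%E.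
Proof.
move=> k0 mf f0.
exact: (@ge0_integral_affine_aux (NngNum (ltW k0)) a k0 f mf f0).
Qed.

Lemma measurable_affine (k a : R) : measurable_fun setT (fun x : R => k * x + a).
Proof.
apply: measurable_funD; last exact: measurable_cst.
by apply: measurable_funM; [exact: measurable_cst|exact: measurable_id].
Qed.

Lemma integrable_affine (k a : R) (f : R -> \bar R) : 0 < k ->
  mu.-integrable setT f -> mu.-integrable setT (fun x => f (k * x + a)%R).
Proof.
move=> k0 /integrableP[mf fi]; apply/integrableP; split.
  exact: (measurableT_comp mf (measurable_affine k a)).
move: fi; rewrite (ge0_integral_affine a k0)//; last exact: measurableT_comp.
by rewrite !ltey; apply: contraNneq => ->; rewrite gt0_muley// lte_fin.
Qed.

Lemma integral_affine (k a : R) (f : R -> \bar R) : 0 < k ->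
  mu.-integrable setT f ->
  (\int[mu]_x f x = k%:E * \int[mu]_x f (k * x + a)%R)%E.
Proof.
move=> k0 fi; have ki := integrable_affine a k0 fi.
have mf := measurable_int _ fi.
rewrite [in LHS]integralE [in RHS]integralE muleBr//; last first.
  exact: integrable_add_def.
rewrite (ge0_integral_affine (f := f^\+%E) a k0)//; last exact: measurable_funepos.
rewrite (ge0_integral_affine (f := f^\-%E) a k0)//; last exact: measurable_funeneg.
congr (_ * _ - _ * _)%E; apply: eq_integral => x _.
  by rewrite (funepos_comp f (fun x => k * x + a)).
by rewrite (funeneg_comp f (fun x => k * x + a)).
Qed.

End LebesgueAffine.

(** * Almost everywhere equality and Fubini for real-valued integrals *)

Section GeneralMeasure.
Context (d1 d2 : measure_display) (T1 : measurableType d1) (T2 : measurableType d2).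
Variable R : realType.

Lemma ae_eq_Rintegral_comp (m : {measure set T1 -> \bar R}) (V : Type) (u : V -> R)
    (g h : T1 -> V) :
  measurable_fun setT (fun t => u (g t)) -> measurable_fun setT (fun t => u (h t)) ->
  {ae m, forall t, g t = h t} ->
  Rintegral m setT (fun t => u (g t)) = Rintegral m setT (fun t => u (h t)).
Proof.
move=> mg mh gh; rewrite /Rintegral; congr fine.
apply: ae_eq_integral => //; [exact/measurable_EFinP|exact/measurable_EFinP|].
by apply: filterS gh => t -> _.
Qed.

Lemma ae_imp (m : {measure set T1 -> \bar R}) (P Q : T1 -> Prop) :
  {ae m, forall x, P x} -> (forall x, P x -> Q x) -> {ae m, forall x, Q x}.
Proof. by move=> mP PQ; apply: filterS mP. Qed.

Lemma abse_fine_le (x : \bar R) : (`|(fine x)%:E| <= `|x|)%E.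
Proof. by case: x => [r||] //=; rewrite normr0 leey. Qed.

Variable m1 : {sigma_finite_measure set T1 -> \bar R}.
Variable m2 : {sigma_finite_measure set T2 -> \bar R}.

(* The inner integral may be infinite on a null set, where [fine] makes it 0. *)
Lemma Rfubini (f : T1 * T2 -> R) : (m1 \x m2)%E.-integrable setT (EFin \o f) ->
  [/\ m1.-integrable setT (fun x => (Rintegral m2 setT (fun y => f (x, y)))%:E),
      m2.-integrable setT (fun y => (Rintegral m1 setT (fun x => f (x, y)))%:E) &
      Rintegral m1 setT (fun x => Rintegral m2 setT (fun y => f (x, y))) =
      Rintegral m2 setT (fun y => Rintegral m1 setT (fun x => f (x, y)))].
Proof.
move=> fi; have a1 := ae_integrable1 fi; have a2 := ae_integrable2 fi.
have mF : measurable_fun setT (fubini_F m2 (EFin \o f)).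
  exact: measurable_int (integrable_fubini_F fi).
have mG := measurable_fubini_G fi.
have e1 : ae_eq m1 setT (fubini_F m2 (EFin \o f))
    (fun x => (Rintegral m2 setT (fun y => f (x, y)))%:E).
  apply: filterS a1 => x ix _; rewrite /Rintegral fineK//.
  exact: integrable_fin_num ix.
have e2 : ae_eq m2 setT (fubini_G m1 (EFin \o f))
    (fun y => (Rintegral m1 setT (fun x => f (x, y)))%:E).
  apply: filterS a2 => x ix _; rewrite /Rintegral fineK//.
  exact: integrable_fin_num ix.
have mi1 : measurable_fun setT (fun x => (Rintegral m2 setT (fun y => f (x, y)))%:E).
  by apply/measurable_EFinP; exact: (measurableT_comp (f := fine)).
have mi2 : measurable_fun setT (fun y => (Rintegral m1 setT (fun x => f (x, y)))%:E).
  by apply/measurable_EFinP; exact: (measurableT_comp (f := fine)).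
have mf := measurable_int _ fi.
split.
- apply/integrableP; split => //.
  have : (\int[m1]_x \int[m2]_y `|(EFin \o f) (x, y)| < +oo)%E.
    by apply/(integrable12ltyP m1 m2).
  apply: le_lt_trans; apply: ge0_le_integral => //.
  - exact: measurableT_comp.
  - apply: (measurable_fun_fubini_tonelli_F (abse \o (EFin \o f))).
      exact: measurableT_comp.
    by move=> z; exact: abse_ge0.
  - move=> x _; rewrite /= /Rintegral.
    apply: (@le_trans _ _ (`|\int[m2]_y (f (x, y))%:E|)%E).
      exact: abse_fine_le.
    apply: le_abse_integral => //.
    exact: (measurableT_comp mf (measurable_pair1 x)).
- apply/integrableP; split => //.
  have : (\int[m2]_y \int[m1]_x `|(EFin \o f) (x, y)| < +oo)%E.
    by apply/(integrable21ltyP m1 m2).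
  apply: le_lt_trans; apply: ge0_le_integral => //.
  - exact: measurableT_comp.
  - apply: (measurable_fun_fubini_tonelli_G (abse \o (EFin \o f))).
      exact: measurableT_comp.
    by move=> z; exact: abse_ge0.
  - move=> y _; rewrite /= /Rintegral.
    apply: (@le_trans _ _ (`|\int[m1]_x (f (x, y))%:E|)%E).
      exact: abse_fine_le.
    apply: le_abse_integral => //.
    exact: (measurableT_comp mf (measurable_pair2 y)).
- rewrite {1 3}/Rintegral; congr fine.
  rewrite -(ae_eq_integral _ _ measurableT mF mi1 e1).
  by rewrite -(ae_eq_integral _ _ measurableT mG mi2 e2); exact: Fubini.
Qed.

End GeneralMeasure.

(** * The complex integral: linearity, scaling, dominated convergence *)

Section ComplexIntegral.
Variable R : realType.
Local Notation C := R[i].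
Local Notation mu := (@lebesgue_measure R).
Local Notation integr := (cintegr mu).
Implicit Types g h : R -> C.

Lemma eq_cint g h : g =1 h -> cint setT g = cint setT h.
Proof. by move=> gh; congr (cint setT _); apply/funext. Qed.

Lemma cint_mkcond (i : interval R) h :
  cint [set` i] h = cint setT (fun t => if t \in i then h t else 0).
Proof.
rewrite /cint; congr (_ +i* _); rewrite Rintegral_mkcond; apply: eq_Rintegral => t _.
  by rewrite /patch mem_setE; case: ifP.
by rewrite /patch mem_setE; case: ifP.
Qed.

Lemma cintegrable_mkcond (i : interval R) h : cintegrable [set` i] h ->
  integr (fun t => if t \in i then h t else 0).
Proof.
move=> [h1 h2]; split.
  have := (@integrable_mkcond _ _ _ mu _ _ (measurable_itv i)).1 h1; apply: eq_integrable => // t _.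
  by rewrite /patch mem_setE; case: ifP.
have := (@integrable_mkcond _ _ _ mu _ _ (measurable_itv i)).1 h2; apply: eq_integrable => // t _.
by rewrite /patch mem_setE; case: ifP.
Qed.

Lemma cintZ (k : C) h : integr h -> cint setT (fun t => k * h t) = k * cint setT h.
Proof.
move=> [h1 h2]; apply: complex_eq.
  rewrite (ReM k) /= -!RintegralZl// -RintegralB//.
  - by apply: eq_Rintegral => t _; rewrite ReM.
  - exact: (integrableZl measurableT _ h1).
  - exact: (integrableZl measurableT _ h2).
rewrite (ImM k) /= -!RintegralZl// -RintegralD//.
- by apply: eq_Rintegral => t _; rewrite ImM.
- exact: (integrableZl measurableT _ h2).
- exact: (integrableZl measurableT _ h1).
Qed.

Lemma cintD g h : integr g -> integr h ->
  cint setT (fun t => g t + h t) = cint setT g + cint setT h.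
Proof.
move=> [g1 g2] [h1 h2]; apply: complex_eq; rewrite /= ?ReD ?ImD /= -RintegralD//.
  by apply: eq_Rintegral => t _; rewrite ReD.
by apply: eq_Rintegral => t _; rewrite ImD.
Qed.

Lemma cint0 : cint setT (fun=> 0 : C) = 0.
Proof. by apply: complex_eq; rewrite /= /Rintegral integral0. Qed.

Lemma cintegr_sum I (r : seq I) (F : I -> R -> C) : (forall i, integr (F i)) ->
  integr (fun t => \sum_(i <- r) F i t).
Proof.
move=> iF; elim: r => [|i r ih].
  by under eq_fun do rewrite big_nil; exact: cintegr0.
by under eq_fun do rewrite big_cons; exact: cintegrD.
Qed.

Lemma cint_sum I (r : seq I) (F : I -> R -> C) : (forall i, integr (F i)) ->
  cint setT (fun t => \sum_(i <- r) F i t) = \sum_(i <- r) cint setT (F i).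
Proof.
move=> iF; elim: r => [|i r ih].
  by under eq_cint do rewrite big_nil; rewrite big_nil cint0.
under eq_cint do rewrite big_cons.
by rewrite big_cons cintD ?ih//; exact: cintegr_sum.
Qed.

(** The real and the imaginary part are estimated separately, whence the factor 2; it is harmless in
    the limits where the bound serves. *)
Lemma normc_cint_le h : integr h ->
  nc (cint setT h) <= 2 * Rintegral mu setT (fun t => nc (h t)).
Proof.
move=> ih; have [h1 h2] := ih; have h3 := integrable_normc ih.
rewrite (le_trans (normc_le_ReIm _))// mulr_natl mulr2n lerD//=.
  apply: le_trans (le_normr_Rintegral measurableT h1) _.
  apply: le_Rintegral => //; last by move=> t _; exact: ler_Re_normc.
  exact: (integrable_norm h1).
apply: le_trans (le_normr_Rintegral measurableT h2) _.
apply: le_Rintegral => //; last by move=> t _; exact: ler_Im_normc.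
exact: (integrable_norm h2).
Qed.

Lemma ae_eq_cint g h : cmeasurable (g : measurableTypeR R -> _) ->
  cmeasurable (h : measurableTypeR R -> _) ->
  {ae mu, forall t, g t = h t} -> cint setT g = cint setT h.
Proof.
move=> mg mh gh; apply: complex_eq.
  rewrite /cint/=.
  have := @ae_eq_Rintegral_comp _ (measurableTypeR R) _ mu _ (@complex.Re R) g h mg.1 mh.1.
  exact.
rewrite /cint/=.
have := @ae_eq_Rintegral_comp _ (measurableTypeR R) _ mu _ (@complex.Im R) g h mg.2 mh.2.
exact.
Qed.

Lemma cintegr_affine (k a : R) h : 0 < k -> integr h ->
  integr (fun t => h (k * t + a)).
Proof.
move=> k0 [h1 h2]; split.
  exact: (integrable_affine a k0 h1).
exact: (integrable_affine a k0 h2).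
Qed.

Lemma cint_affine (k a : R) h : 0 < k -> integr h ->
  cint setT h = k%:C * cint setT (fun t => h (k * t + a)).
Proof.
move=> k0 [h1 h2]; apply: complex_eq; rewrite /= ?ReM ?ImM /= mul0r ?subr0 ?addr0.
  rewrite /Rintegral (integral_affine a k0 h1) fineM//.
  exact: integrable_fin_num (integrable_affine a k0 h1).
rewrite /Rintegral (integral_affine a k0 h2) fineM//.
exact: integrable_fin_num (integrable_affine a k0 h2).
Qed.

Lemma normc_lim_le (v : nat -> C) (l : C) (M : R) :
  (fun n => Re (v n)) @ \oo --> Re l -> (fun n => Im (v n)) @ \oo --> Im l ->
  (forall n, nc (v n) <= M) -> nc l <= 2 * M.
Proof.
move=> cR cI vM; have [nR nI] := (cvg_norm cR, cvg_norm cI).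
rewrite (le_trans (normc_le_ReIm _))// mulr_natl mulr2n lerD//.
  rewrite -(cvg_lim _ nR)//; apply: limr_le; first by apply/cvg_ex; exists `|Re l|.
  by apply: nearW => n; exact: le_trans (ler_Re_normc _) _.
rewrite -(cvg_lim _ nI)//; apply: limr_le; first by apply/cvg_ex; exists `|Im l|.
by apply: nearW => n; exact: le_trans (ler_Im_normc _) _.
Qed.

Lemma cint_cvg (F : nat -> R -> C) h (g : R -> R) :
  (forall n, cmeasurable (F n : measurableTypeR R -> _)) ->
  (forall t, (fun n => Re (F n t)) @ \oo --> Re (h t)) ->
  (forall t, (fun n => Im (F n t)) @ \oo --> Im (h t)) ->
  mu.-integrable setT (EFin \o g) ->
  (forall n t, nc (F n t) <= g t) ->
  (fun n => Re (cint setT (F n))) @ \oo --> Re (cint setT h) /\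
  (fun n => Im (cint setT (F n))) @ \oo --> Im (cint setT h).
Proof.
move=> mF cR cI ig Fg.
have mh := cmeasurable_cvg mF cR cI.
have hg t : nc (h t) <= 2 * g t by exact: normc_lim_le (cR t) (cI t) (Fg^~ t).
have [ih1 ih2] : integr h.
  apply: (cintegr_le mh hg).
  exact: (integrableZl measurableT 2 ig).
split; apply: fine_cvg; rewrite fineK; try exact: integrable_fin_num.
  apply: (@dominated_cvg _ _ _ mu setT measurableT _ _ (EFin \o g)) => //.
  - by move=> n; have [? _] := mF n; exact/measurable_EFinP.
  - by move=> t _; apply: cvg_EFin; [exact: nearW|exact: cR].
  - by move=> n t _ /=; rewrite lee_fin (le_trans (ler_Re_normc _)).
apply: (@dominated_cvg _ _ _ mu setT measurableT _ _ (EFin \o g)) => //.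
- by move=> n; have [_ ?] := mF n; exact/measurable_EFinP.
- by move=> t _; apply: cvg_EFin; [exact: nearW|exact: cI].
- by move=> n t _ /=; rewrite lee_fin (le_trans (ler_Im_normc _)).
Qed.

End ComplexIntegral.

(** * Fubini for complex functions *)

Section Fubini.
Variable R : realType.
Local Notation C := R[i].
Local Notation mu := (@lebesgue_measure R).
Local Notation integr := (cintegr mu).
Local Notation integr2 := (cintegr (mu \x mu)%E).
Implicit Types (F : R * R -> C).

Lemma cfubini_ae1 F : integr2 F -> {ae mu, forall x, integr (fun y => F (x, y))}.
Proof.
move=> [F1 F2]; have a1 := ae_integrable1 F1; have a2 := ae_integrable1 F2.
by apply: filterS2 a1 a2.
Qed.

Lemma cfubini_ae2 F : integr2 F -> {ae mu, forall y, integr (fun x => F (x, y))}.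
Proof.
move=> [F1 F2]; have a1 := ae_integrable2 F1; have a2 := ae_integrable2 F2.
by apply: filterS2 a1 a2.
Qed.

Lemma cfubini F : integr2 F ->
  [/\ integr (fun x => cint setT (fun y => F (x, y))),
      integr (fun y => cint setT (fun x => F (x, y))) &
      cint setT (fun x => cint setT (fun y => F (x, y))) =
      cint setT (fun y => cint setT (fun x => F (x, y)))].
Proof.
move=> [F1 F2].
have [r1 r2 r3] := @Rfubini _ _ _ _ R mu mu (fun z => Re (F z)) F1.
have [i1 i2 i3] := @Rfubini _ _ _ _ R mu mu (fun z => Im (F z)) F2.
split; [by split|by split|].
by rewrite /cint/= r3 i3.
Qed.

End Fubini.

(** * Convolution on the line and its associativity *)

Section Convolution.
Variable R : realType.
Local Notation C := R[i].
Local Notation RR := (measurableTypeR R).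
Local Notation mu := (@lebesgue_measure R).
Local Notation integr := (cintegr mu).
Local Notation integr2 := (cintegr (mu \x mu)%E).
Local Notation cmeas := (@cmeasurable _ RR R).
Implicit Types f g h : R -> C.

Lemma ge0_integral_translate (a : R) (f : R -> \bar R) :
  measurable_fun setT f -> (forall x, (0 <= f x)%E) ->
  (\int[mu]_x f (x - a)%R = \int[mu]_x f x)%E.
Proof.
move=> mf f0; rewrite (ge0_integral_affine (- a) (@ltr01 R) mf f0) mul1e.
by apply: eq_integral => x _; rewrite mul1r.
Qed.

(** Positive and negative parts are translated separately, with possibly infinite integrals, so that
    measurability suffices. [convA] relies on this for slices not known to be integrable. *)
Lemma Rintegral_translate (a : R) (f : R -> R) : measurable_fun setT f ->
  Rintegral mu setT (fun x => f (x - a)) = Rintegral mu setT f.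
Proof.
move=> mf; have mEf : measurable_fun setT (EFin \o f) by exact/measurable_EFinP.
rewrite /Rintegral; congr fine.
rewrite [in LHS]integralE [in RHS]integralE; congr (_ - _)%E.
  under eq_integral do rewrite (funepos_comp (EFin \o f) (fun x => x - a)).
  by rewrite (ge0_integral_translate a (f := (EFin \o f)^\+%E))//; exact: measurable_funepos.
under eq_integral do rewrite (funeneg_comp (EFin \o f) (fun x => x - a)).
by rewrite (ge0_integral_translate a (f := (EFin \o f)^\-%E))//; exact: measurable_funeneg.
Qed.

Lemma cint_translate (a : R) h : cmeas h ->
  cint setT (fun t => h (t - a)) = cint setT h.
Proof.
move=> [h1 h2]; rewrite /cint.
rewrite (Rintegral_translate a (f := fun t => Re (h t)))//.
by rewrite (Rintegral_translate a (f := fun t => Im (h t))).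
Qed.

(** Fubini provides the integrability of the product only. A nonzero [k] can be divided out; for
    [k = 0] both sides vanish whatever [h] is, because [cint] is always a finite number. *)
Lemma cintZ' (k : C) h : integr (fun t => k * h t) ->
  cint setT (fun t => k * h t) = k * cint setT h.
Proof.
move=> ikh; have [->|k0] := eqVneq k 0.
  by under eq_cint do rewrite mul0r; rewrite cint0 mul0r.
apply: cintZ; have := cintegrZ k^-1 ikh.
by under eq_fun do rewrite mulrA mulVf// mul1r.
Qed.

Lemma cintZr' (k : C) h : integr (fun t => h t * k) ->
  cint setT (fun t => h t * k) = cint setT h * k.
Proof.
under eq_fun do rewrite mulrC; move=> ikh.
by rewrite mulrC -cintZ'//; under eq_cint do rewrite mulrC.
Qed.

Lemma measurable_subl (x : R) : measurable_fun setT (fun t : RR => (x - t : RR)).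
Proof.
by apply: measurable_funB; [exact: measurable_cst|exact: measurable_id].
Qed.

Lemma measurable_subr (x : R) : measurable_fun setT (fun t : RR => (t - x : RR)).
Proof.
by apply: measurable_funB; [exact: measurable_id|exact: measurable_cst].
Qed.

Lemma cmeasurable_comp (d : measure_display) (T : measurableType d) (u : T -> RR) h :
  cmeas h -> measurable_fun setT u -> cmeasurable (fun t => h (u t)).
Proof. by move=> [h1 h2] um; split; [exact: (measurableT_comp h1 um)|exact: (measurableT_comp h2 um)]. Qed.

Lemma measurable_sub2 : measurable_fun setT (fun z : RR * RR => (z.1 - z.2 : RR)).
Proof. by apply: measurable_funB; [exact: measurable_fst|exact: measurable_snd]. Qed.

(** A total function: where the integrand is not integrable the value has no meaning, hence the
    almost everywhere statements below. *)
Definition conv g h (x : R) : C := cint setT (fun t => g (x - t) * h t).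

Lemma convE g h x : conv g h x = cint setT (fun t => g (x - t) * h t).
Proof. by []. Qed.

(** Tonelli with the first variable integrated first: by translation invariance the inner integral
    of the modulus is |h(t)| times the L^1 norm of [g]. *)
Lemma conv_integr2 g h : integr g -> integr h ->
  integr2 (fun z => g (z.1 - z.2) * h z.2).
Proof.
move=> ig ih; have mg := cintegr_meas ig; have mh := cintegr_meas ih.
have mgz : cmeasurable (fun z : RR * RR => g (z.1 - z.2)).
  exact: cmeasurable_comp mg measurable_sub2.
have mhz : cmeasurable (fun z : RR * RR => h z.2).
  exact: cmeasurable_comp mh measurable_snd.
apply: (@cintegr_le _ _ R (mu \x mu)%E _ (fun z : RR * RR => nc (g (z.1 - z.2)) * nc (h z.2))).
- exact: cmeasurableM.
- by move=> z; rewrite Normc.normcM.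
apply/(integrable21ltyP mu mu).
  apply/measurable_EFinP; apply: measurable_funM; exact: measurable_normc.
have [_ gfin] := integrableP _ _ _ (integrable_normc ig).
have [_ hfin] := integrableP _ _ _ (integrable_normc ih).
have gE t : (\int[mu]_x `|(nc (g (x - t)%R) * nc (h t))%:E| =
    (nc (h t))%:E * \int[mu]_x `|(nc (g x))%:E|)%E.
  transitivity (\int[mu]_x `|(nc (g x) * nc (h t))%:E|)%E.
    apply: (ge0_integral_translate t (f := fun x => `|(nc (g x) * nc (h t))%:E|%E)).
      apply: measurableT_comp => //; apply/measurable_EFinP.
      by apply: measurable_funM; [exact: measurable_normc|exact: measurable_cst].
    by move=> x; exact: abse_ge0.
  rewrite -ge0_integralZl//.
  - apply: eq_integral => x _ /=.
    by rewrite normrM mulrC EFinM (ger0_norm (normc_ge0 (h t))).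
  - by apply: measurableT_comp => //; exact/measurable_EFinP/measurable_normc.
  - by rewrite lee_fin normc_ge0.
under eq_integral do rewrite /= gE.
rewrite ge0_integralZr//.
- rewrite lte_mul_pinfty//.
  + by apply: integral_ge0 => t _; rewrite lee_fin normc_ge0.
  + rewrite ge0_fin_numE; last by apply: integral_ge0 => t _; rewrite lee_fin normc_ge0.
    by move: hfin; under eq_integral do rewrite gee0_abs ?lee_fin ?normc_ge0//.
- exact/measurable_EFinP/measurable_normc.
- by move=> t _; rewrite lee_fin normc_ge0.
- exact: integral_ge0.
Qed.

Lemma conv_ae g h : integr g -> integr h ->
  {ae mu, forall x, integr (fun t => g (x - t) * h t)}.
Proof. by move=> ig ih; exact: (cfubini_ae1 (conv_integr2 ig ih)). Qed.

Lemma conv_integr g h : integr g -> integr h -> integr (conv g h).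
Proof. by move=> ig ih; have [] := cfubini (conv_integr2 ig ih). Qed.

Lemma cint_conv g h : integr g -> integr h ->
  cint setT (conv g h) = cint setT g * cint setT h.
Proof.
move=> ig ih; have [_ _ /=] := cfubini (conv_integr2 ig ih).
rewrite /conv => ->.
have mg := cintegr_meas ig.
have E t : cint setT (fun x => g (x - t) * h t) = cint setT g * h t.
  under eq_cint do rewrite mulrC.
  rewrite cintZ; first by rewrite (cint_translate _ mg) mulrC.
  have := cintegr_affine (- t) ltr01 ig.
  by under eq_fun do rewrite mul1r.
by under eq_cint do rewrite E; rewrite cintZ.
Qed.

(** The modulus stays complex-valued so that the results on [conv] apply to it. *)
Let cabs h : R -> C := fun t => (nc (h t))%:C.

Let cabs_integr h : integr h -> integr (cabs h).
Proof.
move=> ih; split; first exact: integrable_normc ih.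
exact: integrable0.
Qed.

(** Associativity at a point [x] needs only that the triple convolution of the moduli converges at
    that [x], and [conv_ae] grants this for almost every [x]. *)
Let conv3_integr2 f g h (x : R) : integr f -> integr g -> integr h ->
  integr (fun t => cabs g (x - t) * conv (cabs h) (cabs f) t) ->
  integr2 (fun z => g (x - z.1) * (h (z.1 - z.2) * f z.2)).
Proof.
move=> fi gi hi ix.
have mf := cintegr_meas fi; have mg := cintegr_meas gi; have mh := cintegr_meas hi.
have mgz : cmeasurable (fun z : RR * RR => g (x - z.1)).
  apply: (cmeasurable_comp mg).
  exact: (measurableT_comp (measurable_subl x) measurable_fst).
have mhz : cmeasurable (fun z : RR * RR => h (z.1 - z.2)).
  exact: cmeasurable_comp mh measurable_sub2.
have mfz : cmeasurable (fun z : RR * RR => f z.2).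
  exact: cmeasurable_comp mf measurable_snd.
have mgx : measurable_fun setT (fun t : RR => nc (g (x - t))).
  by apply: measurable_normc; exact: (cmeasurable_comp mg (measurable_subl x)).
apply: (@cintegr_le _ _ R (mu \x mu)%E _ (fun z : RR * RR => nc (g (x - z.1)) * (nc (h (z.1 - z.2)) * nc (f z.2)))).
- by apply: cmeasurableM => //; exact: cmeasurableM.
- by move=> z; rewrite !Normc.normcM.
apply/(integrable12ltyP mu mu).
  apply/measurable_EFinP; apply: measurable_funM; first exact: measurable_normc.
  by apply: measurable_funM; exact: measurable_normc.
have mhf : measurable_fun setT (fun z : RR * RR => (nc (h (z.1 - z.2)) * nc (f z.2))%:E).
  by apply/measurable_EFinP; apply: measurable_funM; exact: measurable_normc.
pose I t := (\int[mu]_s (nc (h (t - s)%R) * nc (f s))%:E)%E.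
have mI : measurable_fun setT I.
  apply: (@measurable_fun_fubini_tonelli_F _ _ RR RR R mu
     (fun z => (nc (h (z.1 - z.2)%R) * nc (f z.2))%:E)) => //.
  by move=> z; rewrite lee_fin mulr_ge0 ?normc_ge0.
have inner t : (\int[mu]_s `|(nc (g (x - t)%R) * (nc (h (t - s)%R) * nc (f s)))%:E| =
    (nc (g (x - t)%R))%:E * I t)%E.
  rewrite /I -ge0_integralZl//.
  - apply: eq_integral => s _ /=.
    by rewrite EFinM ger0_norm// !mulr_ge0 ?normc_ge0.
  - exact: (measurableT_comp mhf (measurable_pair1 t)).
  - by move=> s _; rewrite lee_fin mulr_ge0 ?normc_ge0.
  - by rewrite lee_fin normc_ge0.
under eq_integral do rewrite /= inner.
(* [I] may be infinite on a null set, where [conv] takes a default value instead; the two agree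
   wherever the slice is integrable. *)
have aeI : {ae mu, forall t, I t = (Re (conv (cabs h) (cabs f) t))%:E}.
  have := conv_ae (cabs_integr hi) (cabs_integr fi).
  move/ae_imp; apply => t [it _].
  have e s : nc (h (t - s)) * nc (f s) = Re (cabs h (t - s) * cabs f s).
    by rewrite /= mulr0 subr0.
  rewrite /I; under eq_integral do rewrite e.
  by rewrite /conv/= /Rintegral fineK//; exact: integrable_fin_num it.
have [i1 _] := ix; have mi1 := measurable_int _ i1.
have -> : (\int[mu]_t ((nc (g (x - t)%R))%:E * I t) =
    \int[mu]_t (Re (cabs g (x - t)%R * conv (cabs h) (cabs f) t))%:E)%E.
  apply: ae_eq_integral => //.
    by apply: emeasurable_funM => //; exact/measurable_EFinP.
  by apply: (ae_imp aeI) => t -> _; rewrite ReMreal EFinM.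
exact: (integrable_lty measurableT i1).
Qed.

Lemma convA f g h : integr f -> integr g -> integr h ->
  {ae mu, forall x, conv g (conv h f) x = conv (conv g h) f x}.
Proof.
move=> fi gi hi.
have mf := cintegr_meas fi; have mg := cintegr_meas gi; have mh := cintegr_meas hi.
have := conv_ae (cabs_integr gi) (conv_integr (cabs_integr hi) (cabs_integr fi)).
move/ae_imp; apply => x /(conv3_integr2 fi gi hi) ix.
have [j1 j2 jE] := cfubini ix.
have ae1 := cfubini_ae1 ix; have ae2 := cfubini_ae2 ix.
transitivity (cint setT (fun t => cint setT (fun s => g (x - t) * (h (t - s) * f s)))).
  apply: ae_eq_cint.
  - apply: cmeasurableM; first exact: (cmeasurable_comp mg (measurable_subl x)).
    exact: cintegr_meas (conv_integr hi fi).
  - exact: cintegr_meas j1.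
  - by apply: (ae_imp ae1) => t it; rewrite -cintZ'.
rewrite [LHS]jE; apply: ae_eq_cint.
- exact: cintegr_meas j2.
- apply: cmeasurableM; last exact: mf.
  apply: (cmeasurable_comp _ (measurable_subl x)).
  exact: cintegr_meas (conv_integr gi hi).
- apply: (ae_imp ae2) => s is_ /=.
  under eq_cint do rewrite mulrA.
  rewrite cintZr'; last by move: is_; under eq_fun do rewrite mulrA.
  congr (_ * _); rewrite /conv.
  (* The translation by [s] turns the inner integral into [conv g h (x - s)]. *)
  rewrite -(cint_translate s (h := fun t => g (x - s - t) * h t)).
    by apply: eq_cint => t; congr (g _ * _); rewrite opprB addrA subrK.
  by apply: cmeasurableM; [exact: (cmeasurable_comp mg (measurable_subl _))|exact: mh].
Qed.

End Convolution.

(** * Complex powers on the half-line and their integrability near 0 *)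

Section Powers.
Variable R : realType.
Local Notation C := R[i].
Local Notation RR := (measurableTypeR R).
Local Notation mu := (@lebesgue_measure R).
Local Notation integr := (cintegr mu).
Local Notation cmeas := (@cmeasurable _ RR R).
Implicit Types (z w a b : C) (s t u : R).

Lemma cexpD z w : cexp (z + w) = cexp z * cexp w.
Proof.
apply: complex_eq; rewrite ?ReM ?ImM /= ReD ImD expRD ?cosD ?sinD; ring.
Qed.

Lemma cexp0 : cexp 0 = 1 :> C.
Proof. by apply: complex_eq; rewrite /= expR0 ?cos0 ?sin0 mul1r. Qed.

Lemma normc_cexp z : nc (cexp z) = expR (Re z).
Proof.
rewrite normcE2 /= !exprMn -mulrDr cos2Dsin2 mulr1 sqrtr_sqr.
by rewrite ger0_norm// expR_ge0.
Qed.

Lemma cpowD t z w : cpow t (z + w) = cpow t z * cpow t w.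
Proof. by rewrite /cpow mulrDr cexpD. Qed.

Lemma cpowMl s t z : 0 < s -> 0 < t -> cpow (s * t) z = cpow s z * cpow t z.
Proof. by move=> s0 t0; rewrite /cpow lnM// rmorphD/= mulrDl cexpD. Qed.

Lemma cpow0 t : cpow t 0 = 1 :> C.
Proof. by rewrite /cpow mulr0 cexp0. Qed.

Lemma cpow1 t : 0 < t -> cpow t 1 = t%:C :> C.
Proof.
move=> t0; rewrite /cpow mulr1; apply: complex_eq; rewrite /=.
  by rewrite lnK// cos0 mulr1.
by rewrite sin0 mulr0.
Qed.

Lemma cpow_neq0 t z : cpow t z != 0.
Proof.
apply/eqP => tz0; have := expR_gt0 (Re ((ln t)%:C * z)).
by rewrite -normc_cexp -/(cpow t z) tz0 Normc.normc0 ltxx.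
Qed.

Lemma cpowX t z n : cpow t z ^+ n = cpow t (z * n%:R).
Proof.
elim: n => [|n ih]; first by rewrite mulr0 cpow0.
by rewrite exprS ih -cpowD -natr1 mulrDr mulr1 addrC.
Qed.

Lemma normc_cpow t z : nc (cpow t z) = expR (ln t * Re z).
Proof. by rewrite normc_cexp ReMreal. Qed.

(* [pw a] is t^(a-1) on the positive half-line, extended by 0, so that convolving
   it over the whole line yields the Beta integrals. *)
Definition pw a t : C := if 0 < t then cpow t (a - 1) else 0.
Definition rpw (x : R) t : R := if 0 < t then expR (ln t * (x - 1)) else 0.

Lemma normc_pw a t : nc (pw a t) = rpw (Re a) t.
Proof.
rewrite /pw /rpw; case: ifP => _; last by rewrite Normc.normc0.
by rewrite normc_cpow ReB.
Qed.

Lemma rpw_ge0 (x : R) t : 0 <= rpw x t.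
Proof. by rewrite /rpw; case: ifP => // _; exact: expR_ge0. Qed.

Lemma measurable_gt0 : measurable_fun setT (fun t : RR => (0 < t)%R).
Proof. by apply: measurable_fun_ltr; [exact: measurable_cst|exact: measurable_id]. Qed.

Lemma cmeasurable_cpow z : cmeas (fun t => cpow t z).
Proof.
have m k : measurable_fun setT (fun t : RR => ln t * k).
  by apply: measurable_funM; [exact: measurable_ln|exact: measurable_cst].
split => /=.
  under eq_fun do rewrite ReMreal ImMreal.
  apply: measurable_funM.
    by apply: measurableT_comp; [exact: measurable_expR|exact: m].
  by apply: measurableT_comp; [exact: continuous_measurable_fun (@continuous_cos R)|exact: m].
under eq_fun do rewrite ReMreal ImMreal.
apply: measurable_funM.
  by apply: measurableT_comp; [exact: measurable_expR|exact: m].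
by apply: measurableT_comp; [exact: continuous_measurable_fun (@continuous_sin R)|exact: m].
Qed.

Lemma cmeasurable_pw a : cmeas (pw a).
Proof.
apply: cmeasurable_if; [exact: measurable_gt0|exact: cmeasurable_cpow|].
exact: cmeasurable_cst.
Qed.

Lemma measurable_rpw x : measurable_fun setT (rpw x).
Proof.
have -> : rpw x = fun t => nc (pw x%:C t) by apply/funext => t; rewrite normc_pw.
exact: measurable_normc (cmeasurable_pw _).
Qed.

Lemma pwM k a t : 0 < k -> pw a (k * t) = cpow k (a - 1) * pw a t.
Proof.
move=> k0; rewrite /pw pmulr_rgt0//; case: ifP => t0; last by rewrite mulr0.
by rewrite cpowMl.
Qed.

Lemma pw_add a b t : pw (a + b) t = pw a t * cpow t b.
Proof.
rewrite /pw; case: ifP => _; last by rewrite mul0r.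
by rewrite -cpowD addrAC.
Qed.

Lemma rpw_powR (x t : R) : 0 < t -> rpw x t = t `^ (x - 1).
Proof. by move=> t0; rewrite /rpw t0 /powR gt_eqF// mulrC. Qed.

Lemma is_derive_rpw (x t : R) : 0 < x -> 0 < t ->
  is_derive t 1 (fun t => x^-1 * t `^ x) (rpw x t).
Proof.
move=> x0 t0; have dP := is_derive1_powR x t0.
rewrite rpw_powR//; have -> : t `^ (x - 1) = x^-1 *: (x * t `^ (x - 1)).
  by rewrite /GRing.scale/= mulrA mulVf ?mul1r// gt_eqF.
exact: is_deriveZ.
Qed.

Lemma continuous_rpw (x t : R) : 0 < t -> {for t, continuous (rpw x)}.
Proof.
move=> t0; have : {for t, continuous (fun t => expR (ln t * (x - 1)))}.
  apply: continuous_comp; last exact: continuous_expR.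
  by apply: cvgM; [exact: continuous_ln|exact: cvg_cst].
rewrite /prop_for /continuous_at {2}/rpw t0; apply: cvg_trans; apply: near_eq_cvg.
near=> s; rewrite /rpw ifT//; near: s; exact: lt_nbhsr.
Unshelve. all: by end_near. Qed.

Lemma bigcup_itv_inv_nat :
  \bigcup_n `[(n.+1%:R : R)^-1, 1]%classic = `]0, 1]%classic :> set R.
Proof.
apply/seteqP; split => t /=.
  by move=> [n _] /=; rewrite !in_itv/= => /andP[h ->]; rewrite (lt_le_trans _ h).
rewrite in_itv/= => /andP[t0 t1]; exists (Num.truncn t^-1) => //=.
rewrite in_itv/= t1 andbT invf_ple ?posrE//.
by rewrite ltW// truncnS_gt.
Qed.

(** The primitive t^x / x equals 1/x at 1 and is nonnegative at e, which makes the bound uniform in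
    [e]. *)
Lemma integral_rpw_le (x e : R) : 0 < x -> 0 < e -> e <= 1 ->
  (\int[mu]_(t in `[e, 1%R]) (rpw x t)%:E <= (x^-1)%:E)%E.
Proof.
(* The degenerate case [e = 1] is the first interval of the exhaustion of []0, 1]]. *)
move=> x0 e0; rewrite le_eqVlt => /predU1P[->|e1].
  by rewrite set_itv1 integral_set1 lee_fin invr_ge0 ltW.
rewrite (@continuous_FTC2 _ (rpw x) (fun t => x^-1 * t `^ x))//.
- by rewrite powR1 mulr1 -EFinB lee_fin gerBl mulr_ge0 ?powR_ge0// invr_ge0 ltW.
- apply: continuous_in_subspaceT => t; rewrite inE/= in_itv/= => /andP[t0 _].
  by apply: continuous_rpw; exact: lt_le_trans t0.
- split.
  + move=> t; rewrite in_itv/= => /andP[t0 _].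
    by have [] := is_derive_rpw x0 (lt_trans e0 t0).
  + have [/derivable1_diffP/differentiable_continuous cF _] := is_derive_rpw x0 e0.
    exact: cvg_at_right_filter cF.
  + have [/derivable1_diffP/differentiable_continuous cF _] := is_derive_rpw x0 ltr01.
    exact: cvg_at_left_filter cF.
- move=> t; rewrite in_itv/= => /andP[t0 _]; rewrite derive1E.
  by have [] := is_derive_rpw x0 (lt_trans e0 t0).
Qed.

Lemma integral_rpw01_le (x : R) : 0 < x ->
  (\int[mu]_(t in `]0%R, 1%R]) (rpw x t)%:E <= (x^-1)%:E)%E.
Proof.
move=> x0; rewrite -bigcup_itv_inv_nat.
have cv : (\int[mu]_(t in `[(n.+1%:R^-1)%R, 1%R]) (rpw x t)%:E)%E @[n --> \oo] -->
    (\int[mu]_(t in \bigcup_n `[(n.+1%:R^-1)%R, 1%R]%classic) (rpw x t)%:E)%E.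
  apply: (@ge0_nondecreasing_set_cvg_integral _ RR R) => //.
  - move=> n m nm; rewrite subsetEset; apply: subset_itvr.
    by rewrite bnd_simp lef_pV2 ?posrE// ler_nat.
  - by move=> n; apply/measurable_EFinP; exact: measurable_funTS (measurable_rpw x).
  - by move=> n t _; rewrite lee_fin rpw_ge0.
rewrite -(cvg_lim _ cv)//; apply: lime_le; first by apply/cvg_ex; eexists; exact: cv.
apply: nearW => n; apply: integral_rpw_le => //.
by rewrite invf_le1// ler1n.
Qed.

Lemma integrable_rpw01 (x : R) : 0 < x ->
  mu.-integrable setT (fun t : RR => (if t < 1 then rpw x t else 0)%:E).
Proof.
move=> x0; apply/integrableP; split.
  apply/measurable_EFinP; apply: measurable_fun_ifT.
  - by apply: measurable_fun_ltr; [exact: measurable_id|exact: measurable_cst].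
  - exact: measurable_rpw.
  - exact: measurable_cst.
apply: le_lt_trans (ltry x^-1); apply: le_trans (integral_rpw01_le x0).
rewrite [leRHS]integral_mkcond; apply: ge0_le_integral => //.
- apply: measurableT_comp => //; apply/measurable_EFinP; apply: measurable_fun_ifT.
  + by apply: measurable_fun_ltr; [exact: measurable_id|exact: measurable_cst].
  + exact: measurable_rpw.
  + exact: measurable_cst.
- apply/(measurable_restrictT _ _).1 => //.
  by apply/measurable_EFinP; exact: measurable_funTS (measurable_rpw x).
- move=> t _; rewrite /patch mem_setE in_itv/=.
  case: ifP => [t1|_]; last by rewrite normr0; case: ifP => // _; rewrite lee_fin rpw_ge0.
  rewrite (ltW t1) andbT ger0_norm ?rpw_ge0//; case: ifP => // t0.
  by rewrite /rpw t0.
Qed.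

End Powers.

(** * Gamma and Beta integrals *)

Section GammaBeta.
Variable R : realType.
Local Notation C := R[i].
Local Notation RR := (measurableTypeR R).
Local Notation mu := (@lebesgue_measure R).
Local Notation integr := (cintegr mu).
Local Notation cmeas := (@cmeasurable _ RR R).
Implicit Types (z w a b : C) (s t u : R).

Definition gam a t : C := pw a t * cexp (- t%:C).

Lemma GammaE a : Gamma a = cint setT (gam a).
Proof.
rewrite /Gamma cint_mkcond; apply: eq_cint => t.
by rewrite in_itv/= andbT /gam /pw; case: ifP => _ //; rewrite mul0r.
Qed.

Lemma cmeasurable_cexpN : cmeas (fun t => cexp (- t%:C)).
Proof.
have mN : measurable_fun setT (fun t : RR => - t).
  by apply: measurableT_comp => //; exact: measurable_id.
split => /=.
  under eq_fun do rewrite oppr0 cos0 mulr1.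
  by apply: measurableT_comp; [exact: measurable_expR|exact: mN].
under eq_fun do rewrite oppr0 sin0 mulr0.
exact: measurable_cst.
Qed.

Lemma cmeasurable_gam a : cmeas (gam a).
Proof. by apply: cmeasurableM; [exact: cmeasurable_pw|exact: cmeasurable_cexpN]. Qed.

Lemma normc_gam a t : nc (gam a t) = rpw (Re a) t * expR (- t).
Proof. by rewrite Normc.normcM normc_pw normc_cexp ReN. Qed.

Lemma rpw_expR_bound (x : R) : exists2 K : R, 0 <= K &
  forall t, 1 <= t -> rpw x t * expR (- t) <= K * expR (- (2^-1 * t)).
Proof.
pose n := Num.truncn `|x - 1|.
have nx : x - 1 <= n.+1%:R.
  by rewrite (le_trans (ler_norm _))// ltW// truncnS_gt.
(* For t >= 1, t^(x-1) <= t^(n+1), and e^(t/2) >= (t/2)^(n+1) / (n+1)!. Half of the exponential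
   absorbs the power, the other half stays integrable. *)
exists (2 ^+ n.+1 * n.+1`!%:R); first by rewrite mulr_ge0// exprn_ge0.
move=> t t1; have t0 : 0 < t by rewrite (lt_le_trans ltr01).
have -> : expR (- t) = expR (- (2^-1 * t)) * expR (- (2^-1 * t)).
  by rewrite -expRD; congr expR; field.
rewrite mulrA ler_wpM2r ?expR_ge0// expRN ler_pdivrMr ?expR_gt0//.
apply: (@le_trans _ _ (t ^+ n.+1)).
  rewrite /rpw t0 -[t in leRHS]lnK// -expRM_natl mulrC ler_expR.
  by rewrite ler_wpM2r// ln_ge0.
have h : 0 <= 2^-1 * t by rewrite mulr_ge0// ltW.
have := expR_ge1Dxn n h.
rewrite exprMn exprVn => /(le_trans _) e; rewrite -mulrA -ler_pdivrMl ?exprn_gt0//.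
rewrite -ler_pdivrMl ?ltr0n ?fact_gt0//; rewrite [leLHS]mulrC; apply: e.
by rewrite lerDr.
Qed.

Lemma integrable_expRN_half :
  mu.-integrable setT (fun t : RR => (exponential_pdf 2^-1 t)%:E).
Proof.
apply/integrableP; split.
  by apply/measurable_EFinP; exact: measurable_exponential_pdf.
under eq_integral do rewrite gee0_abs ?lee_fin ?exponential_pdf_ge0//.
by rewrite integral_exponential_pdf// ltry.
Qed.

Lemma gam_integr a : 0 < Re a -> integr (gam a).
Proof.
move=> a0; have [K K0 HK] := rpw_expR_bound (Re a).
(* The power dominates below 1, the exponential beyond; the 2 in [2 * K] cancels the rate 1/2 in
   front of the exponential density. *)
apply: (@cintegr_le _ RR R mu _ (fun t : R => (if t < 1 then rpw (Re a) t else 0) +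
   2 * K * exponential_pdf 2^-1 t)).
- exact: cmeasurable_gam.
- move=> t; rewrite normc_gam; case: ifPn => [t1|].
    apply: (@le_trans _ _ (rpw (Re a) t)).
      have [t0|t0] := ltP 0 t; last by rewrite /rpw ltNge t0/= mul0r.
      by rewrite ler_piMr ?rpw_ge0// -expR0 ler_expR oppr_le0 ltW.
    by rewrite lerDl mulr_ge0 ?exponential_pdf_ge0// mulr_ge0.
  rewrite -leNgt add0r => t1; apply: (le_trans (HK t t1)).
  rewrite /exponential_pdf /patch mem_setE in_itv/= andbT (le_trans ler01 t1).
  rewrite mulrA [2 * K]mulrC -[K * 2 * _]mulrA divff// mulr1 mulNr.
  exact: lexx.
- have := integrableD measurableT (integrable_rpw01 a0)
    (integrableZl measurableT (2 * K) integrable_expRN_half).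
  by apply: eq_integrable.
Qed.

(** The exponentials multiply to e^(-u), which does not depend on [t]: a convolution of Gamma
    integrands is therefore a Beta integral times e^(-u). *)
Lemma gam_conv a b u t :
  gam a (u - t) * gam b t = cexp (- u%:C) * (pw a (u - t) * pw b t).
Proof.
have -> : cexp (- u%:C) = cexp (- (u - t)%:C) * cexp (- t%:C) :> C.
  by rewrite -cexpD; congr cexp; rewrite -opprD -rmorphD/= subrK.
by rewrite /gam; ring.
Qed.

Lemma ae_exists_gt0 (P : R -> Prop) : {ae mu, forall x : RR, P x} ->
  exists2 x, 0 < x & P x.
Proof.
move=> [A [mA A0 PA]]; apply: contrapT => nex.
have : (mu (`]0%R, 1%R[ : set R) <= mu A)%E.
  apply: le_measure; rewrite ?inE//.
  move=> t /=; rewrite in_itv/= => /andP[t0 _]; apply: PA => /= Pt.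
  by apply: nex; exists t.
by rewrite A0 lebesgue_measure_itv/= lte_fin ltr01 oppr0 adde0 lee_fin ler10.
Qed.

Lemma beta_scale a b (k u t : R) : 0 < k ->
  pw a (k * u - k * t) * pw b (k * t) =
  cpow k (a - 1 + (b - 1)) * (pw a (u - t) * pw b t).
Proof. by move=> k0; rewrite -mulrBr !pwM// (cpowD k (a - 1)); ring. Qed.

(** No estimate near the two singularities is made. The convolution of [gam a] and [gam b] converges
    almost everywhere, hence at some v > 0; removing e^(-v) and rescaling by v / u carries this to
    every u > 0. For u <= 0 the supports are disjoint. *)
Lemma beta_integr a b u : 0 < Re a -> 0 < Re b ->
  integr (fun t => pw a (u - t) * pw b t).
Proof.
move=> a0 b0; have [u0|u0] := ltP 0 u; last first.
  rewrite (_ : (fun t => _) = fun=> 0); first exact: cintegr0.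
  apply/funext => t; rewrite /pw; case: ifP => ut; rewrite ?mul0r//.
  case: ifP => t0; rewrite ?mulr0//; exfalso.
  by move: ut; rewrite subr_gt0 => /(lt_trans t0); rewrite ltNge u0.
have [v v0 iv] := ae_exists_gt0 (conv_ae (gam_integr a0) (gam_integr b0)).
have {}iv : integr (fun t => pw a (v - t) * pw b t).
  have := cintegrZ (cexp v%:C) iv.
  rewrite (_ : (fun t => _) = (fun t => pw a (v - t) * pw b t))//.
  apply/funext => t; rewrite gam_conv mulrA -cexpD subrr cexp0 mul1r//.
have k0 : 0 < v / u by exact: divr_gt0.
have := cintegrZ (cpow (v / u) (a - 1 + (b - 1)))^-1 (cintegr_affine 0 k0 iv).
rewrite (_ : (fun t => _) = (fun t => pw a (u - t) * pw b t))//.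
apply/funext => t; rewrite addr0.
have -> : v = v / u * u by rewrite divfK// gt_eqF.
rewrite [in X in pw a X](_ : v / u * u / u = v / u); last by rewrite mulfK// gt_eqF.
rewrite [in X in pw b X](_ : v / u * u / u = v / u); last by rewrite mulfK// gt_eqF.
rewrite [in X in cpow X](_ : v / u * u / u = v / u); last by rewrite mulfK// gt_eqF.
by rewrite beta_scale// mulrA mulVf ?cpow_neq0// mul1r.
Qed.

(** The Beta function, the integral of (1-t)^(a-1) t^(b-1) over ]0, 1[. *)
Definition Bt a b : C := conv (pw a) (pw b) 1.

Lemma conv_pw a b u : 0 < Re a -> 0 < Re b ->
  conv (pw a) (pw b) u = pw (a + b) u * Bt a b.
Proof.
move=> a0 b0; rewrite /conv; have [u0|u0] := ltP 0 u; last first.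
  rewrite [pw (a + b) u]/pw ltNge u0/= mul0r -[RHS](cint0 R); apply: eq_cint => t.
  rewrite /pw; case: ifP => ut; rewrite ?mul0r//.
  case: ifP => t0; rewrite ?mulr0//; exfalso.
  by move: ut; rewrite subr_gt0 => /(lt_trans t0); rewrite ltNge u0.
rewrite (cint_affine 0 u0 (beta_integr u a0 b0)).
have e t : pw a (u - (u * t + 0)) * pw b (u * t + 0) =
   cpow u (a - 1 + (b - 1)) * (pw a (1 - t) * pw b t).
  by rewrite addr0 -beta_scale// mulr1.
under eq_cint do rewrite e.
rewrite cintZ; last exact: beta_integr.
(* The Jacobian [u] contributes the missing 1: 1 + (a - 1) + (b - 1) = a + b - 1. *)
rewrite mulrA /pw u0 -cpow1// -cpowD; congr (cpow _ _ * _); ring.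
Qed.

(** The product on the left is the integral of the convolution of [gam a] and [gam b], which equals
    [Bt a b] times [gam (a + b)] pointwise. *)
Lemma Gamma_Beta a b : 0 < Re a -> 0 < Re b ->
  Gamma a * Gamma b = Gamma (a + b) * Bt a b.
Proof.
move=> a0 b0; have ab0 : 0 < Re (a + b) by rewrite ReD addr_gt0.
have ia := gam_integr a0; have ib := gam_integr b0.
rewrite !GammaE -(cint_conv ia ib).
rewrite mulrC -cintZ; last exact: gam_integr.
apply: eq_cint => u; rewrite /conv.
under eq_cint do rewrite gam_conv.
rewrite cintZ; last exact: beta_integr.
rewrite -/(conv (pw a) (pw b) u) conv_pw// /gam; ring.
Qed.

Lemma Gamma1 : Gamma 1 = 1 :> C.
Proof.
have g1 : integr (gam 1) by apply: gam_integr; rewrite /= ltr01.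
rewrite GammaE; apply: complex_eq => /=.
  transitivity (Rintegral mu setT (fun t => exponential_pdf (1:R) t)).
    rewrite /Rintegral; congr fine; apply: ae_eq_integral => //.
    - by case: g1 => /measurable_int.
    - by apply/measurable_EFinP; exact: measurable_exponential_pdf.
    (* At 0 the density is 1 and [pw] is 0; everywhere else they agree. *)
    - exists [set 0 : R]; split => //; first exact: lebesgue_measure_set1.
      move=> t /= /not_implyP[_]; apply: contra_notP => /eqP t0.
      congr EFin; rewrite /exponential_pdf /patch mem_setE in_itv/= andbT /gam /pw subrr.
      rewrite le_eqVlt eq_sym (negbTE t0)/=; case: ifP => // _; last by rewrite mul0r.
      by rewrite cpow0 mul1r /= oppr0 cos0 mulr1 mul1r mulN1r.
  by rewrite /Rintegral integral_exponential_pdf.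
rewrite /Rintegral (_ : (fun t => _) = fun=> 0%E); first by rewrite integral0.
apply/funext => t; congr EFin; rewrite /gam /pw subrr; case: ifP => _.
  by rewrite cpow0 mul1r /= oppr0 sin0 mulr0.
by rewrite mul0r.
Qed.

End GammaBeta.

(** * Gamma has no zero in the right half-plane; decay of 1/Gamma *)

Section GammaNonzero.
Variable R : realType.
Local Notation C := R[i].
Local Notation RR := (measurableTypeR R).
Local Notation mu := (@lebesgue_measure R).
Local Notation integr := (cintegr mu).
Local Notation cmeas := (@cmeasurable _ RR R).
Implicit Types (z w a b : C) (s t u : R).

Lemma cvg_eqr (T : Type) (F : set_system T) (x y : T -> R) (p q : R) :
  x =1 y -> p = q -> y @ F --> q -> x @ F --> p.
Proof. by move=> /funext -> ->. Qed.

Lemma ccvgM (T : Type) (F : set_system T) {FF : Filter F} (v1 v2 : T -> C) (l1 l2 : C) :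
  (fun n => Re (v1 n)) @ F --> Re l1 -> (fun n => Im (v1 n)) @ F --> Im l1 ->
  (fun n => Re (v2 n)) @ F --> Re l2 -> (fun n => Im (v2 n)) @ F --> Im l2 ->
  (fun n => Re (v1 n * v2 n)) @ F --> Re (l1 * l2) /\
  (fun n => Im (v1 n * v2 n)) @ F --> Im (l1 * l2).
Proof.
move=> r1 i1 r2 i2; rewrite ReM ImM; split.
  by apply: (cvg_eqr _ erefl (cvgB (cvgM r1 r2) (cvgM i1 i2))) => n; rewrite ReM.
by apply: (cvg_eqr _ erefl (cvgD (cvgM r1 i2) (cvgM i1 r2))) => n; rewrite ImM.
Qed.

Lemma cvg_expR_cos (T : Type) (F : set_system T) {FF : Filter F} (x y : T -> R) (p q : R) :
  x @ F --> p -> y @ F --> q -> (fun n => expR (x n) * cos (y n)) @ F --> expR p * cos q.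
Proof.
move=> cx cy; apply: cvgM.
  by apply: continuous_cvg => //; exact: continuous_expR.
by apply: continuous_cvg => //; exact: continuous_cos.
Qed.

Lemma cvg_expR_sin (T : Type) (F : set_system T) {FF : Filter F} (x y : T -> R) (p q : R) :
  x @ F --> p -> y @ F --> q -> (fun n => expR (x n) * sin (y n)) @ F --> expR p * sin q.
Proof.
move=> cx cy; apply: cvgM.
  by apply: continuous_cvg => //; exact: continuous_expR.
by apply: continuous_cvg => //; exact: continuous_sin.
Qed.

Lemma cpow_near1 z : exists2 u : R, 0 < u < 1 &
  forall t, u <= t < 1 -> 2^-1 <= Re (cpow t z).
Proof.
have cv : (fun t => Re (cpow t z)) @ (1 : R) --> (1 : R).
  apply: (cvg_eqr (y := fun t => expR (ln t * Re z) * cos (ln t * Im z))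
                  (q := expR (ln 1 * Re z) * cos (ln 1 * Im z))).
  - by move=> t; rewrite -ReMreal -ImMreal.
  - by rewrite ln1 !mul0r expR0 cos0 mulr1.
  apply: cvg_expR_cos.
    by apply: cvgM; [exact: continuous_ln|exact: cvg_cst].
  by apply: cvgM; [exact: continuous_ln|exact: cvg_cst].
have /(cvgr_gt _ cv) : (2^-1 : R) < 1 by rewrite invf_lt1// ltr1n.
move=> /nbhs_ballP[e /= e0 he].
(* [1 - e / 2] keeps [t] strictly within [e] of 1, and [2^-1] keeps the witness positive. *)
exists (Num.max 2^-1 (1 - e / 2)).
  rewrite lt_max invr_gt0 ltr0n/= gt_max invf_lt1// ltr1n/=.
  by rewrite ltrBlDr ltrDl divr_gt0.
move=> t /andP[]; rewrite ge_max => /andP[_ te] t1.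
apply/ltW/he; rewrite /ball/= ger0_norm ?subr_ge0 ?ltW//.
move: te; rewrite lerBlDr -lerBlDl => te; apply: (le_lt_trans te).
by rewrite ltr_pdivrMr// ltr_pMr// ltr1n.
Qed.

(** If [Bt 1 w] were 0, then by homogeneity the integral of t^(w-1) over ]0, u[ would vanish for
    every u, hence also the one over [u, 1[. For u close to 1 the integrand there has real part at
    least 1/2. *)
Lemma Beta1_neq0 w : 0 < Re w -> Bt 1 w != 0.
Proof.
move=> w0; apply/eqP => B0.
have one0 : 0 < Re (1 : C) by rewrite /= ltr01.
have [u /andP[u0 u1] hu] := cpow_near1 (w - 1).
have i1 := beta_integr 1 one0 w0; have iu := beta_integr u one0 w0.
have iD := cintegrD i1 (cintegrZ (-1) iu).
have E : cint setT (fun t => pw 1 (1 - t) * pw w t + -1 * (pw 1 (u - t) * pw w t)) = 0.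
  rewrite cintD//; last exact: cintegrZ.
  rewrite cintZ// -/(conv (pw 1) (pw w) 1) -/(conv (pw 1) (pw w) u) !conv_pw// B0.
  by rewrite !mulr0 addr0.
pose k t : R := if (u <= t) && (t < 1) then 2^-1 else 0.
have le t : k t <= Re (pw 1 (1 - t) * pw w t + -1 * (pw 1 (u - t) * pw w t)).
  rewrite /k /pw !subr_gt0 subrr !cpow0.
  have [ut|ut] /= := leP u t; last first.
    by rewrite (lt_trans ut u1) ?mul1r mulN1r subrr.
  rewrite mul0r mulr0 addr0; case: ifP => t1; last by rewrite mul0r.
  by rewrite (lt_le_trans u0 ut) mul1r; apply: hu; rewrite ut.
have ik : mu.-integrable setT (EFin \o k).
  have := @integrable_indic_itv R u 1 true true.
  move=> /(integrableZl measurableT 2^-1); apply: eq_integrable => // t _.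
  rewrite /k /= indicE mem_setE in_itv/= -EFinM.
  by case: (_ && _); rewrite ?mulr1 ?mulr0.
have kE : Rintegral mu setT k = 2^-1 * (1 - u).
  have -> : k = ((fun=> 2^-1) : R -> R) \_ `[u, 1[%classic.
    by apply/funext => t; rewrite /k /patch mem_setE in_itv.
  rewrite -Rintegral_mkcond; transitivity (2^-1 * fine (mu (`[u, 1[%classic : set R))).
    exact: Rintegral_cst.
  by rewrite lebesgue_measure_itv/= lte_fin u1 -EFinB.
have := le_Rintegral measurableT ik iD.1 (fun t _ => le t).
rewrite kE.
have -> : Rintegral mu setT (fun t => Re (pw 1 (1 - t) * pw w t + -1 * (pw 1 (u - t) * pw w t)))
  = 0 by have := congr1 (@complex.Re R) E.
by apply/negP; rewrite -ltNge mulr_gt0// subr_gt0.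
Qed.

(** By dominated convergence Gamma(1 + z / 2^n) tends to Gamma(1) = 1. The majorant is the sum of
    the moduli at the end points: for 0 <= e <= 1, t^(e Re z) lies between 1 and t^(Re z). *)
Lemma Gamma_near1 z : 0 < Re z -> ~ (forall n, Gamma (1 + z / (2 ^+ n)) = 0).
Proof.
move=> z0 G0.
have one0 : 0 < Re (1 : C) by rewrite /= ltr01.
pose e n : R := (2 ^+ n)^-1.
have e0 n : 0 <= e n by rewrite invr_ge0 exprn_ge0.
have e1 n : e n <= 1 by rewrite invf_le1 ?exprn_gt0// exprn_ege1// ler1n.
have zE n : z / 2 ^+ n = (e n)%:C * z.
  by rewrite mulrC; congr (_ * _); rewrite /e fmorphV/= rmorphXn/= rmorph_nat.
have ecv : e @ \oo --> (0 : R).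
  have -> : e = (fun n => (2^-1 : R) ^+ n) by apply/funext => n; rewrite /e exprVn.
  by apply: cvg_expr; rewrite ger0_norm// invf_lt1// ltr1n.
have gE (n : nat) t : 0 < t -> gam (1 + z / 2 ^+ n) t =
    cexp ((e n * (ln t))%:C * z) * cexp (- t%:C).
  move=> t0; rewrite /gam /pw t0 addrAC subrr add0r zE /cpow.
  by congr (cexp _ * _); rewrite mulrA -rmorphM/= [ln t * _]mulrC.
have g1E t : 0 < t -> gam 1 t = cexp (- t%:C).
  by move=> t0; rewrite /gam /pw t0 subrr cpow0 mul1r.
have gle0 w t : t <= 0 -> gam w t = 0.
  by move=> t0; rewrite /gam /pw ltNge t0/= mul0r.
have mF n : cmeas (gam (1 + z / 2 ^+ n)) by exact: cmeasurable_gam.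
have Icv (c : R) : (fun n => e n * c) @ \oo --> (0 : R).
  by rewrite -[X in _ --> X](mul0r c); apply: cvgM => //; exact: cvg_cst.
have cR t : (fun n => Re (gam (1 + z / 2 ^+ n) t)) @ \oo --> Re (gam 1 t).
  have [t0|t0] := ltP 0 t; last first.
    by apply: (cvg_eqr (y := fun=> 0)) (cvg_cst _) => [n|]; rewrite gle0.
  apply: (cvg_eqr (y := fun n => expR (e n * (ln t * Re z)) * cos (e n * (ln t * Im z)) *
    Re (cexp (- t%:C))) (q := expR 0 * cos 0 * Re (cexp (- t%:C)))).
  - move=> n; rewrite gE// ReM [Im (cexp (- t%:C))]/= oppr0 sin0 !mulr0 subr0.
    by rewrite [Re (cexp (_ * z))]/= ReMreal ImMreal !mulrA.
  - by rewrite g1E// expR0 cos0 !mul1r.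
  by apply: cvgM; [exact: cvg_expR_cos|exact: cvg_cst].
have cI t : (fun n => Im (gam (1 + z / 2 ^+ n) t)) @ \oo --> Im (gam 1 t).
  have [t0|t0] := ltP 0 t; last first.
    by apply: (cvg_eqr (y := fun=> 0)) (cvg_cst _) => [n|]; rewrite gle0.
  apply: (cvg_eqr (y := fun n => expR (e n * (ln t * Re z)) * sin (e n * (ln t * Im z)) *
    Re (cexp (- t%:C))) (q := expR 0 * sin 0 * Re (cexp (- t%:C)))).
  - move=> n; rewrite gE// ImM [Im (cexp (- t%:C))]/= oppr0 sin0 !mulr0 add0r.
    by rewrite [Im (cexp (_ * z))]/= ReMreal ImMreal !mulrA.
  - by rewrite g1E// /= oppr0 !sin0 !mulr0 mul0r.
  by apply: cvgM; [exact: cvg_expR_sin|exact: cvg_cst].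
have z1 : 0 < Re (1 + z) by rewrite ReD addr_gt0.
have ig : mu.-integrable setT (EFin \o (fun t => nc (gam 1 t) + nc (gam (1 + z) t))).
  exact: (integrableD measurableT (integrable_normc (gam_integr one0))
     (integrable_normc (gam_integr z1))).
have Fg n t : nc (gam (1 + z / 2 ^+ n) t) <= nc (gam 1 t) + nc (gam (1 + z) t).
  have [t0|t0] := ltP 0 t; last by rewrite !gle0// Normc.normc0 addr0.
  rewrite !normc_gam -mulrDl ler_wpM2r ?expR_ge0// /rpw t0 zE !ReD ReMreal /=.
  rewrite addrAC subrr mulr0 expR0 add0r addrAC subrr add0r.
  have [lt0|lt0] := leP 0 (ln t).
    rewrite (@le_trans _ _ (expR (ln t * Re z)))// ?lerDr//.
    by rewrite ler_expR ler_wpM2l// ler_piMl// ltW.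
  rewrite (@le_trans _ _ 1)// ?lerDl ?expR_ge0//.
  by rewrite -expR0 ler_expR nmulr_rle0// mulr_ge0// ltW.
have [cv _] := cint_cvg mF cR cI ig Fg.
have : (fun n => Re (cint setT (gam (1 + z / 2 ^+ n)))) @ \oo --> (0 : R).
  by under eq_fun do rewrite -GammaE G0; exact: cvg_cst.
move/(cvg_unique _ cv); rewrite -GammaE Gamma1 /= => /(_ (@Rhausdorff R))/eqP.
by rewrite oner_eq0.
Qed.

Lemma Gamma_neq0 z : 0 < Re z -> Gamma z != 0.
Proof.
move=> z0; apply/eqP => Gz0; apply: (Gamma_near1 z0) => n.
have p n' : 0 < Re (z / 2 ^+ n').
  have -> : z / 2 ^+ n' = ((2 ^+ n')^-1)%:C * z.
    by rewrite mulrC; congr (_ * _); rewrite fmorphV/= rmorphXn/= rmorph_nat.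
  by rewrite ReMreal mulr_gt0// invr_gt0 exprn_gt0.
have Gn : Gamma (z / 2 ^+ n) = 0.
  elim: n => [|n ih]; first by rewrite expr0 divr1.
  (* Gamma(w)^2 = Gamma(2w) B(w, w) sends a zero at 2w to a zero at w. *)
  have := Gamma_Beta (p n.+1) (p n.+1).
  have -> : z / 2 ^+ n.+1 + z / 2 ^+ n.+1 = z / 2 ^+ n.
    by rewrite exprS; field; rewrite expf_neq0// pnatr_eq0.
  by rewrite ih mul0r => /eqP; rewrite mulf_eq0 orbb => /eqP.
have one0 : 0 < Re (1 : C) by rewrite /= ltr01.
have := Gamma_Beta one0 (p n); rewrite Gn mulr0 => /esym/eqP.
by rewrite mulf_eq0 (negbTE (Beta1_neq0 (p n))) orbF => /eqP.
Qed.

Lemma pw_real (x t : R) : pw x%:C t = (rpw x t)%:C.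
Proof.
rewrite /pw /rpw; case: ifP => // _.
have -> : x%:C - 1 = (x - 1)%:C :> C by rewrite rmorphB.
rewrite /cpow -rmorphM; apply: complex_eq => /=.
  by rewrite cos0 mulr1.
by rewrite sin0 mulr0.
Qed.

(** The modulus of a Beta integrand is the Beta integrand of the real parts, so that decay is only
    to be shown for real arguments. *)
Lemma normc_Bt_le a b : 0 < Re a -> 0 < Re b ->
  nc (Bt a b) <= 2 * Re (Bt (Re a)%:C (Re b)%:C).
Proof.
move=> a0 b0; have iab := beta_integr 1 a0 b0.
apply: le_trans (normc_cint_le iab) _; rewrite ler_wpM2l//=.
rewrite le_eqVlt; apply/orP; left; apply/eqP; apply: eq_Rintegral => t _.
by rewrite Normc.normcM !normc_pw !pw_real ReMreal.
Qed.

(** On ]0, 1[ the n-th integrand is the one for n = 0 times the n-th power of (1-t)^y < 1: it tends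
    to 0 pointwise and is dominated by the case n = 0. *)
Lemma Bt_cvg0 (x y : R) : 0 < x -> 0 < y ->
  (fun n => Re (Bt (y * n%:R + x)%:C y%:C)) @ \oo --> (0 : R).
Proof.
move=> x0 y0.
have ixy := @beta_integr R x%:C y%:C 1 x0 y0.
pose F n t : C := pw (y * n%:R + x)%:C (1 - t) * pw y%:C t.
have mF n : cmeas (F n).
  apply: cmeasurableM; last exact: cmeasurable_pw.
  exact: (cmeasurable_comp (cmeasurable_pw _) (measurable_subl 1)).
have FE n t : F n t = (rpw (y * n%:R + x) (1 - t) * rpw y t)%:C.
  by rewrite /F !pw_real -rmorphM.
have rE n t : 0 < t -> 0 < 1 - t ->
    rpw (y * n%:R + x) (1 - t) = rpw x (1 - t) * expR (ln (1 - t) * y) ^+ n.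
  move=> t0 t1; rewrite /rpw t1 -expRM_natl -expRD; congr expR.
  by rewrite -mulr_natl; ring.
have lt1 t : 0 < t -> 0 < 1 - t -> expR (ln (1 - t) * y) < 1.
  move=> t0 t1; rewrite -[ltRHS]expR0 ltr_expR pmulr_llt0//.
  by apply: ln_lt0; rewrite t1/= ltrBlDr ltrDl.
have cv t : (fun n => rpw (y * n%:R + x) (1 - t) * rpw y t) @ \oo --> (0 : R).
  have [t0|t0] := ltP 0 t; last first.
    apply: (cvg_eqr (y := fun=> 0)) (cvg_cst _) => // n.
    by rewrite [X in _ * X]/rpw ltNge t0/= mulr0.
  have [t1|t1] := ltP 0 (1 - t); last first.
    apply: (cvg_eqr (y := fun=> 0)) (cvg_cst _) => // n.
    by rewrite [X in X * _]/rpw ltNge t1/= mul0r.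
  apply: (cvg_eqr (y := fun n => rpw x (1 - t) * expR (ln (1 - t) * y) ^+ n * rpw y t)
                  (q := rpw x (1 - t) * 0 * rpw y t)).
  - by move=> n; rewrite rE.
  - by rewrite mulr0 mul0r.
  apply: cvgM; last exact: cvg_cst.
  apply: cvgM; first exact: cvg_cst.
  by apply: cvg_expr; rewrite ger0_norm ?expR_ge0// lt1.
have cR t : (fun n => Re (F n t)) @ \oo --> Re (0 : C).
  by apply: cvg_eqr (cv t) => // n; rewrite FE.
have cI t : (fun n => Im (F n t)) @ \oo --> Im (0 : C).
  by apply: cvg_eqr (cvg_cst _) => // n; rewrite FE.
have Fg n t : nc (F n t) <= nc (F 0%N t).
  rewrite !FE !normc_real !ger0_norm ?mulr_ge0 ?rpw_ge0//.
  have [t0|t0] := ltP 0 t; last by rewrite ![rpw y t]/rpw ltNge t0/= !mulr0.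
  rewrite ler_wpM2r ?rpw_ge0//.
  have [t1|t1] := ltP 0 (1 - t); last by rewrite /rpw ltNge t1.
  by rewrite !rE// ler_wpM2l ?rpw_ge0// expr0 exprn_ile1 ?expR_ge0// ltW// lt1.
have ig : mu.-integrable setT (EFin \o (fun t => nc (F 0%N t))).
  have := integrable_normc ixy; apply: eq_integrable => // t _.
  by rewrite /F mulr0 add0r.
have [+ _] := cint_cvg mF cR cI ig Fg.
by rewrite cint0.
Qed.

Lemma invGamma_ratio a z : 0 < Re a -> 0 < Re z ->
  (nc (Gamma (a + z)))^-1 <=
  2 * Re (Bt (Re z)%:C (Re a)%:C) / nc (Gamma a) * (nc (Gamma z))^-1.
Proof.
move=> a0 z0; have az0 : 0 < Re (z + a) by rewrite ReD addr_gt0.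
have Ga := normc_gt0 (Gamma_neq0 a0); have Gz := normc_gt0 (Gamma_neq0 z0).
have Gaz := normc_gt0 (Gamma_neq0 az0).
rewrite addrC -mulrA -invfM ler_pdivlMr ?mulr_gt0//.
apply: le_trans (normc_Bt_le z0 a0).
rewrite mulrC ler_pdivrMr// -!Normc.normcM [Gamma a * _]mulrC (Gamma_Beta z0 a0).
by rewrite mulrC.
Qed.

End GammaNonzero.

(** * The Chu-Vandermonde identity *)

Section Vandermonde.
Variable F : numFieldType.
Implicit Types x y : F.

(** The coefficient of u^n in (1-u)^(-x). *)
Definition risf x (n : nat) : F := (\prod_(k < n) (x + k%:R)) / n`!%:R.

Lemma risf0 x : risf x 0 = 1.
Proof. by rewrite /risf big_ord0 fact0 divr1. Qed.

Lemma risfS x n : n.+1%:R * risf x n.+1 = (x + n%:R) * risf x n.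
Proof.
rewrite /risf big_ord_recr/= factS natrM invfM.
have n0 : n.+1%:R != 0 :> F by rewrite pnatr_eq0.
have f0 : n`!%:R != 0 :> F by rewrite pnatr_eq0 -lt0n fact_gt0.
by move: n.+1%:R n0 n`!%:R f0 => c c0 f f0; field; rewrite ?c0 ?f0.
Qed.

(** Induction after multiplying by n + 1: writing n + 1 = i + (n + 1 - i) lets [risfS] lower the
    index of one factor in each half, and the halves recombine into x + y + n times the previous
    sum. *)
Lemma risf_Vandermonde x y n :
  \sum_(i < n.+1) risf x i * risf y (n - i) = risf (x + y) n.
Proof.
elim: n => [|n ih]; first by rewrite big_ord1 !risf0 mulr1.
have n0 : n.+1%:R != 0 :> F by rewrite pnatr_eq0.
apply: (mulfI n0); rewrite risfS -ih mulr_sumr mulr_sumr.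
have -> : \sum_(i < n.+2) n.+1%:R * (risf x i * risf y (n.+1 - i)) =
    \sum_(i < n.+2) i%:R * risf x i * risf y (n.+1 - i) +
    \sum_(i < n.+2) risf x i * ((n.+1 - i)%:R * risf y (n.+1 - i)).
  rewrite -big_split; apply: eq_bigr => i _ /=.
  have -> : n.+1%:R = i%:R + (n.+1 - i)%:R :> F by rewrite -natrD subnKC// -ltnS.
  by ring.
rewrite big_ord_recl /= !mul0r add0r [X in _ + X]big_ord_recr/= subnn mul0r mulr0 addr0.
rewrite -big_split; apply: eq_bigr => i _ /=.
rewrite /bump leq0n add1n subSS risfS subSn; last by rewrite -ltnS.
rewrite risfS.
have -> : n%:R = i%:R + (n - i)%:R :> F by rewrite -natrD subnKC// -ltnS.
by ring.
Qed.

End Vandermonde.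

(** * Square and triangular double sums *)

Section Triangles.

Lemma big_triangle (V : zmodType) (f : nat -> nat -> V) N :
  \sum_(n < N) \sum_(i < n.+1) f i (n - i)%N = \sum_(i < N) \sum_(j < N - i) f i j.
Proof.
elim: N => [|N ih]; first by rewrite !big_ord0.
rewrite big_ord_recr/= ih [RHS]big_ord_recr/= [X in _ + X]big_ord_recr/= addrA; congr (_ + _).
  rewrite -big_split; apply: eq_bigr => i _ /=.
  by rewrite subSn ?big_ord_recr//= ltnW.
by rewrite subSn// subnn big_ord1.
Qed.

Variable R : realType.
Local Notation C := R[i].

(** Pairs of the square i, j < N outside the triangle i + j < N lie in the larger triangle i + j <
    2N. *)
Lemma square_sub_triangle_le (f : nat -> nat -> C) (g : nat -> nat -> R) N :
  (forall i j, nc (f i j) <= g i j) ->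
  nc (\sum_(i < N) \sum_(j < N) f i j - \sum_(n < N) \sum_(i < n.+1) f i (n - i)%N) <=
  \sum_(n < N + N) \sum_(i < n.+1) g i (n - i)%N -
  \sum_(n < N) \sum_(i < n.+1) g i (n - i)%N.
Proof.
move=> fg; have g0 i j : 0 <= g i j by apply: le_trans (fg i j); exact: normc_ge0.
have split_sum (V : zmodType) (h : nat -> nat -> V) (i : 'I_N) :
    \sum_(j < N) h i j = \sum_(j < N - i) h i j + \sum_(N - i <= j < N) h i j.
  rewrite -!(big_mkord xpredT (h i)) [RHS]/= -big_cat_nat//.
  by rewrite leq_subr.
rewrite !big_triangle.
under eq_bigr do rewrite split_sum.
rewrite big_split/= addrAC subrr add0r.
apply: le_trans (normc_sum _ _ _) _.
rewrite lerBrDl.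
apply: (@le_trans _ _ (\sum_(i < N) \sum_(j < N) g i j)).
  rewrite -big_split/=; apply: ler_sum => i _; rewrite split_sum lerD2l.
  by apply: le_trans (normc_sum _ _ _) _; apply: ler_sum => j _; exact: fg.
rewrite big_split_ord/= -[leLHS]addr0 lerD//; last first.
  by apply: sumr_ge0 => i _; apply: sumr_ge0.
apply: ler_sum => i _.
rewrite -(big_mkord xpredT (g i)) -(big_mkord xpredT (g i)).
rewrite [leRHS](@big_cat_nat _ _ _ N)//=; last first.
  by rewrite -addnBA ?leq_addr// ltnW.
by rewrite lerDl sumr_ge0.
Qed.

End Triangles.

(** * The kernel series: bounds and convergence *)

Section Series.
Variable R : realType.
Local Notation C := R[i].
Implicit Types (al B om r : C) (s : R).

Lemma ratio_sum_bounded (a e : nat -> R) : (forall n, 0 <= a n) ->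
  (forall n, a n.+1 <= e n * a n) -> e @ \oo --> (0 : R) ->
  exists2 M, 0 <= M & forall N, \sum_(n < N) a n <= M.
Proof.
move=> a0 ae /cvgr_lt /(_ _ (_ : (0 : R) < 2^-1)).
rewrite invr_gt0 ltr0n => /(_ isT)[K _ hK].
have sum_ge0 N : 0 <= \sum_(n < N) a n by exact: sumr_ge0.
exists (\sum_(n < K) a n + 2 * a K); first by rewrite addr_ge0// mulr_ge0.
(* From K on terms at least halve, so the sum plus twice the next term does not increase: that term
   joins the sum once, and its second copy pays for twice its successor. *)
have main k : \sum_(n < K + k) a n + 2 * a (K + k)%N <= \sum_(n < K) a n + 2 * a K.
  elim: k => [|k ih]; first by rewrite addn0.
  apply: le_trans ih; rewrite addnS big_ord_recr/= -addrA lerD2l.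
  have : a (K + k).+1 <= 2^-1 * a (K + k)%N.
    apply: le_trans (ae _) _; rewrite ler_wpM2r// ltW//.
    by apply: hK; rewrite /= leq_addr.
  lra.
move=> N; have [NK|KN] := leqP N K.
  rewrite -(subnKC NK) big_split_ord/= -addrA lerDl addr_ge0//.
    exact: sumr_ge0.
  by rewrite mulr_ge0.
rewrite -(subnKC (ltnW KN)); apply: le_trans (main (N - K)%N).
by rewrite lerDl mulr_ge0.
Qed.

Lemma risf_ge0 (r : R) n : 0 <= r -> 0 <= risf r n.
Proof.
move=> r0; rewrite /risf divr_ge0//; apply: prodr_ge0 => k _.
by rewrite addr_ge0.
Qed.

Lemma normc_risf_le r n : nc (risf r n) <= risf (nc r) n.
Proof.
rewrite /risf Normc.normcM Normc.normcV normc_nat ler_wpM2r ?invr_ge0//.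
elim: n => [|n ih]; first by rewrite !big_ord0 Normc.normc1.
rewrite !big_ord_recr/= Normc.normcM ler_pM ?normc_ge0//.
by rewrite (le_trans (le_normcD _ _))// normc_nat.
Qed.

Lemma risfS_le (r : R) n : 0 <= r -> risf r n.+1 <= (r + 1) * risf r n.
Proof.
move=> r0; have n0 : 0 < n.+1%:R :> R by rewrite ltr0n.
rewrite -(ler_pM2l n0) risfS [leRHS]mulrA; apply: ler_wpM2r; first exact: risf_ge0.
rewrite -natr1 mulrDl mulrDr !mulrDr !mulr1 mul1r.
have : 0 <= n%:R * r by rewrite mulr_ge0.
by have : 0 <= n%:R :> R by []; lra.
Qed.

(** The term of index n without its Pochhammer coefficient: convolution adds the indices of [wt]
    exactly, while the coefficients are left to Chu-Vandermonde. *)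
Definition wt al B om n s : C :=
  om ^+ n / Gamma (al * n%:R + B) * pw (al * n%:R + B) s.

Definition KN al B om r N s : C := \sum_(n < N) risf r n * wt al B om n s.

Definition Ker al B om r s : C := pw B s * ML al B r (om * cpow s al).

Lemma Re_alB_gt0 al B n : 0 < Re al -> 0 < Re B -> 0 < Re (al * n%:R + B).
Proof.
move=> a0 b0; rewrite ReD ReM Im_nat mulr0 subr0 Re_nat ltr_wpDl//.
by rewrite mulr_ge0// ltW.
Qed.

(** The ratio of consecutive terms is at most (r + 1) |om| L times the Beta bound of
    [invGamma_ratio], which tends to 0. [r] is real in order to serve both as |r| and as |r1| +
    |r2|. *)
Lemma wt_coef_bounded al B om (r L : R) : 0 < Re al -> 0 < Re B -> 0 <= r -> 0 <= L ->
  exists2 M, 0 <= M & forall N, \sum_(n < N)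
    risf r n * (nc om ^+ n * (nc (Gamma (al * n%:R + B)))^-1 * L ^+ n) <= M.
Proof.
move=> a0 b0 r0 L0.
pose e n := 2 * Re (Bt (Re al * n%:R + Re B)%:C (Re al)%:C) / nc (Gamma al).
apply: (@ratio_sum_bounded
  (fun n => risf r n * (nc om ^+ n * (nc (Gamma (al * n%:R + B)))^-1 * L ^+ n))
  (fun n => (r + 1) * (nc om * L) * e n)).
- move=> n; rewrite mulr_ge0 ?risf_ge0// !mulr_ge0 ?exprn_ge0 ?normc_ge0//.
  by rewrite invr_ge0 normc_ge0.
- move=> n; have zn := Re_alB_gt0 n a0 b0.
  have := invGamma_ratio a0 zn.
  have -> : al + (al * n%:R + B) = al * n.+1%:R + B by rewrite -natr1; ring.
  have -> : Re (al * n%:R + B) = Re al * n%:R + Re B.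
    by rewrite ReD ReM Im_nat Re_nat mulr0 subr0.
  rewrite -/(e n); set D1 := (nc _)^-1; set D0 := (nc _)^-1 => D10.
  have D10' : 0 <= D1 by rewrite invr_ge0 normc_ge0.
  rewrite !exprS.
  have -> : risf r n.+1 * (nc om * nc om ^+ n * D1 * (L * L ^+ n)) =
    (nc om * L * (nc om ^+ n * L ^+ n)) * (risf r n.+1 * D1) by ring.
  have -> : (r + 1) * (nc om * L) * e n * (risf r n * (nc om ^+ n * D0 * L ^+ n)) =
    (nc om * L * (nc om ^+ n * L ^+ n)) * (((r + 1) * risf r n) * (e n * D0)) by ring.
  rewrite ler_wpM2l ?mulr_ge0 ?exprn_ge0 ?normc_ge0//.
  by rewrite ler_pM ?risf_ge0// risfS_le.
- rewrite -[X in _ --> X](mulr0 ((r + 1) * (nc om * L))); apply: cvgM; first exact: cvg_cst.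
  rewrite -[X in _ --> X](mul0r (nc (Gamma al))^-1); apply: cvgM; last exact: cvg_cst.
  rewrite -[X in _ --> X](mulr0 2); apply: cvgM; first exact: cvg_cst.
  exact: Bt_cvg0.
Qed.

Lemma normc_wt_le al B om n s x : 0 < Re al -> 0 < s -> s <= x ->
  nc (wt al B om n s) <= nc om ^+ n * (nc (Gamma (al * n%:R + B)))^-1 *
     expR (ln x * Re al) ^+ n * rpw (Re B) s.
Proof.
move=> a0 s0 sx; have x0 := lt_le_trans s0 sx.
rewrite /wt !Normc.normcM Normc.normcV normcX normc_pw -!mulrA.
rewrite !ler_wpM2l ?exprn_ge0 ?invr_ge0 ?normc_ge0//.
rewrite /rpw s0 ReD ReM Im_nat Re_nat mulr0 subr0 -expRM_natl -expRD ler_expR.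
have h : ln s * Re al <= ln x * Re al by rewrite ler_wpM2r ?(ltW a0)// ler_ln ?posrE.
have -> : ln s * (Re al * n%:R + Re B - 1) = n%:R * (ln s * Re al) + ln s * (Re B - 1).
  by ring.
by rewrite lerD2r ler_wpM2l.
Qed.

(** Uniform in [s] up to [x], by taking L = x^(Re al): all that remains of [s] is the singular
    factor s^(Re B - 1), integrable at 0. *)
Lemma wt_sum_bounded al B om (r x : R) : 0 < Re al -> 0 < Re B -> 0 <= r ->
  exists2 M, 0 <= M & forall s N, 0 < s -> s <= x ->
    \sum_(n < N) risf r n * nc (wt al B om n s) <= M * rpw (Re B) s.
Proof.
move=> a0 b0 r0.
have [M M0 hM] := wt_coef_bounded om a0 b0 r0 (expR_ge0 (ln x * Re al)).
exists M => // s N s0 sx; apply: (le_trans _ (ler_wpM2r (rpw_ge0 _ _) (hM N))).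
rewrite mulr_suml; apply: ler_sum => n _; rewrite -[leRHS]mulrA.
apply: ler_wpM2l; first exact: risf_ge0.
exact: normc_wt_le.
Qed.

Lemma KN_le al B om r x : 0 < Re al -> 0 < Re B ->
  exists2 M, 0 <= M & forall s N, s <= x -> nc (KN al B om r N s) <= M * rpw (Re B) s.
Proof.
move=> a0 b0; have [M M0 hM] := wt_sum_bounded om x a0 b0 (normc_ge0 r).
exists M => // s N sx; have [s0|s0] := ltP 0 s; last first.
  rewrite /KN big1 ?Normc.normc0 ?mulr_ge0 ?rpw_ge0// => n _.
  by rewrite /wt /pw ltNge s0/= !mulr0.
apply: le_trans (hM s N s0 sx); apply: le_trans (normc_sum _ _ _) _.
apply: ler_sum => n _; rewrite Normc.normcM ler_wpM2r ?normc_ge0//.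
exact: normc_risf_le.
Qed.

Lemma KN_ML al B om r N s :
  KN al B om r N s = pw B s * ML_partial al B r (om * cpow s al) N.
Proof.
rewrite /KN /ML_partial mulr_sumr; apply: eq_bigr => n _.
rewrite /wt [al * _ + B]addrC pw_add -cpowX exprMn /risf /pochhammer invfM.
by ring.
Qed.

Lemma cvg_real_imag_sum (u : nat -> C) (M : R) :
  (forall N, \sum_(n < N) nc (u n) <= M) ->
  cvgn (fun N => Re (\sum_(n < N) u n)) /\ cvgn (fun N => Im (\sum_(n < N) u n)).
Proof.
move=> uM; have main (p : C -> R) : (forall z, `|p z| <= nc z) ->
    cvgn (fun N => \sum_(n < N) p (u n)).
  move=> hp; have -> : (fun N => \sum_(n < N) p (u n)) = series (fun n => p (u n)).
    by apply/funext => N; rewrite /series/= big_mkord.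
  apply: normed_cvg; apply: nondecreasing_is_cvgn.
    by apply: nondecreasing_series => n _ _; exact: normr_ge0.
  exists M => _ [N _ <-]; rewrite /normed_series_of seriesEord/=; apply: le_trans (uM N).
  by apply: ler_sum => n _; exact: hp.
split.
  have -> : (fun N => Re (\sum_(n < N) u n)) = (fun N => \sum_(n < N) Re (u n)).
    by apply/funext => N; rewrite Re_sum.
  by apply: main; exact: ler_Re_normc.
have -> : (fun N => Im (\sum_(n < N) u n)) = (fun N => \sum_(n < N) Im (u n)).
  by apply/funext => N; rewrite Im_sum.
by apply: main; exact: ler_Im_normc.
Qed.

Lemma KN_cvg al B om r s : 0 < Re al -> 0 < Re B ->
  (fun N => Re (KN al B om r N s)) @ \oo --> Re (Ker al B om r s) /\
  (fun N => Im (KN al B om r N s)) @ \oo --> Im (Ker al B om r s).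
Proof.
move=> a0 b0; have [s0|s0] := ltP 0 s; last first.
  have e N : KN al B om r N s = 0 by rewrite KN_ML /pw ltNge s0 mul0r.
  rewrite /Ker /pw ltNge s0 mul0r.
  by split; apply: cvg_eqr (cvg_cst _) => // N; rewrite e.
have [M M0 hM] := wt_sum_bounded om s a0 b0 (normc_ge0 r).
have p0 : pw B s != 0 by rewrite /pw s0 cpow_neq0.
have np : 0 < nc (pw B s) by exact: normc_gt0.
have [] := @cvg_real_imag_sum (fun n => pochhammer r n * (om * cpow s al) ^+ n /
    (Gamma (al * n%:R + B) * (n`!)%:R)) M.
  move=> N; have := hM s N s0 (lexx s).
  (* The bound concerns the kernel terms; dividing by |pw B s|, which is nonzero, gives absolute
     convergence of the Mittag-Leffler series itself. *)
  rewrite -normc_pw => h; rewrite -(ler_pM2r np); apply: le_trans h; rewrite mulr_suml.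
  apply: ler_sum => n _; rewrite -Normc.normcM.
  apply: (@le_trans _ _ (nc (risf r n * wt al B om n s))); last first.
    by rewrite Normc.normcM ler_wpM2r ?normc_ge0// normc_risf_le.
  rewrite le_eqVlt; apply/orP; left; apply/eqP; congr nc.
  rewrite /wt [al * _ + B]addrC pw_add -cpowX exprMn /risf /pochhammer invfM.
  by ring.
move=> cR cI; have cR' : (fun N => Re (ML_partial al B r (om * cpow s al) N)) @ \oo -->
    Re (ML al B r (om * cpow s al)) by exact: cR.
have cI' : (fun N => Im (ML_partial al B r (om * cpow s al) N)) @ \oo -->
    Im (ML al B r (om * cpow s al)) by exact: cI.
have [kR kI] := ccvgM (cvg_cst (Re (pw B s))) (cvg_cst (Im (pw B s))) cR' cI'.
by split; [apply: cvg_eqr kR|apply: cvg_eqr kI] => // N; rewrite KN_ML.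
Qed.

End Series.

(** * Convolution of two kernels *)

Section KernelConvolution.
Variable R : realType.
Local Notation C := R[i].
Local Notation RR := (measurableTypeR R).
Local Notation mu := (@lebesgue_measure R).
Local Notation integr := (cintegr mu).
Local Notation cmeas := (@cmeasurable _ RR R).
Implicit Types (al B om r : C) (s t u x : R).

Lemma cmeasurable_wt al B om n : cmeas (wt al B om n).
Proof. by apply: cmeasurableM; [exact: cmeasurable_cst|exact: cmeasurable_pw]. Qed.

Lemma cmeasurable_KN al B om r N : cmeas (KN al B om r N).
Proof.
apply: (@cmeasurable_sum _ RR R N (fun n s => risf r n * wt al B om n s)) => n.
by apply: cmeasurableM; [exact: cmeasurable_cst|exact: cmeasurable_wt].
Qed.

Lemma cmeasurable_Ker al B om r : 0 < Re al -> 0 < Re B -> cmeas (Ker al B om r).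
Proof.
move=> a0 b0; apply: (cmeasurable_cvg (F := KN al B om r)).
- by move=> N; exact: cmeasurable_KN.
- by move=> s; have [] := KN_cvg om r s a0 b0.
- by move=> s; have [] := KN_cvg om r s a0 b0.
Qed.

Lemma Ker_le0 al B om r s : s <= 0 -> Ker al B om r s = 0.
Proof. by move=> s0; rewrite /Ker /pw ltNge s0 mul0r. Qed.

Lemma KN_le0 al B om r N s : s <= 0 -> KN al B om r N s = 0.
Proof. by move=> s0; rewrite KN_ML /pw ltNge s0 mul0r. Qed.

Lemma Ker_le al B om r x : 0 < Re al -> 0 < Re B ->
  exists2 M, 0 <= M & forall s, s <= x -> nc (Ker al B om r s) <= M * rpw (Re B) s.
Proof.
move=> a0 b0; have [M M0 hM] := KN_le om r x a0 b0.
exists (2 * M); first by rewrite mulr_ge0.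
move=> s sx; have [cR cI] := KN_cvg om r s a0 b0.
rewrite -mulrA; apply: normc_lim_le cR cI _ => N; exact: hM.
Qed.

(** The Beta value is exactly the quotient of the Gamma normalisations, which is where the
    nonvanishing of Gamma enters. *)
Lemma conv_wt al B1 B2 om i j x : 0 < Re al -> 0 < Re B1 -> 0 < Re B2 ->
  integr (fun t => wt al B1 om i (x - t) * wt al B2 om j t) /\
  conv (wt al B1 om i) (wt al B2 om j) x = wt al (B1 + B2) om (i + j) x.
Proof.
move=> a0 b1 b2; have h1 := Re_alB_gt0 i a0 b1; have h2 := Re_alB_gt0 j a0 b2.
pose k := om ^+ i / Gamma (al * i%:R + B1) * (om ^+ j / Gamma (al * j%:R + B2)).
have e t : wt al B1 om i (x - t) * wt al B2 om j t =
    k * (pw (al * i%:R + B1) (x - t) * pw (al * j%:R + B2) t).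
  by rewrite /wt /k; ring.
have ib := beta_integr x h1 h2; split.
  by have := cintegrZ k ib; congr (cintegr _ _); apply/funext => t; rewrite e.
rewrite /conv; under eq_cint do rewrite e.
rewrite cintZ// -/(conv (pw (al * i%:R + B1)) (pw (al * j%:R + B2)) x) conv_pw//.
have G := Gamma_Beta h1 h2.
have G1 := Gamma_neq0 h1; have G2 := Gamma_neq0 h2.
have h12 : 0 < Re (al * i%:R + B1 + (al * j%:R + B2)) by rewrite ReD addr_gt0.
have G12 := Gamma_neq0 h12.
have eS : al * (i + j)%:R + (B1 + B2) = al * i%:R + B1 + (al * j%:R + B2).
  by rewrite natrD; ring.
rewrite /wt eS exprD.
have -> : Bt (al * i%:R + B1) (al * j%:R + B2) =
    Gamma (al * i%:R + B1) * Gamma (al * j%:R + B2) /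
    Gamma (al * i%:R + B1 + (al * j%:R + B2)).
  by rewrite G mulrAC divff// mul1r.
rewrite /k; move: (Gamma _) (Gamma _) (Gamma _) G1 G2 G12 {G} => g1 g2 g3 G1 G2 G3.
by field; rewrite G1 G2 G3.
Qed.

Lemma conv_KN al B1 B2 om r1 r2 N x : 0 < Re al -> 0 < Re B1 -> 0 < Re B2 ->
  conv (KN al B1 om r1 N) (KN al B2 om r2 N) x =
  \sum_(i < N) \sum_(j < N) risf r1 i * risf r2 j * wt al (B1 + B2) om (i + j) x.
Proof.
move=> a0 b1 b2; rewrite /conv.
pose f (i j : nat) t := risf r1 i * risf r2 j * (wt al B1 om i (x - t) * wt al B2 om j t).
have e t : KN al B1 om r1 N (x - t) * KN al B2 om r2 N t =
    \sum_(i < N) \sum_(j < N) f i j t.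
  rewrite /KN mulr_suml; apply: eq_bigr => i _; rewrite mulr_sumr.
  by apply: eq_bigr => j _; rewrite /f; ring.
under eq_cint do rewrite e.
have fi i j : integr (f i j) by apply: cintegrZ; have [] := conv_wt om i j x a0 b1 b2.
rewrite (cint_sum _ (F := fun (i : 'I_N) t => \sum_(j < N) f i j t)); last first.
  by move=> i; apply: (cintegr_sum _ (F := fun (j : 'I_N) t => f i j t)).
apply: eq_bigr => i _; rewrite (cint_sum _ (F := fun (j : 'I_N) t => f i j t))//.
apply: eq_bigr => j _; have [iw <-] := conv_wt om i j x a0 b1 b2.
by rewrite /f cintZ.
Qed.

(** By Chu-Vandermonde the triangle of [f] is the partial sum for r1 + r2, and the triangle of the
    majorant [g] is the partial sum [T] for |r1| + |r2|. As [T] converges, T(2N) - T(N) tends to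
    0. *)
Lemma KN_square_cvg al B om r1 r2 x : 0 < Re al -> 0 < Re B -> 0 < x ->
  (fun N => nc (\sum_(i < N) \sum_(j < N) risf r1 i * risf r2 j * wt al B om (i + j) x -
                KN al B om (r1 + r2) N x)) @ \oo --> (0 : R).
Proof.
move=> a0 b0 x0.
pose r := nc r1 + nc r2; have r0 : 0 <= r by rewrite addr_ge0 ?normc_ge0.
pose f i j := risf r1 i * risf r2 j * wt al B om (i + j) x.
pose g i j := risf (nc r1) i * risf (nc r2) j * nc (wt al B om (i + j) x).
have fg i j : nc (f i j) <= g i j.
  rewrite /f /g Normc.normcM (Normc.normcM (risf r1 i)).
  apply: ler_wpM2r; first exact: normc_ge0.
  by apply: ler_pM; rewrite ?normc_ge0// normc_risf_le.
pose T N := \sum_(n < N) risf r n * nc (wt al B om n x).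
have gT N : \sum_(n < N) \sum_(i < n.+1) g i (n - i)%N = T N.
  apply: eq_bigr => n _; rewrite -risf_Vandermonde mulr_suml.
  by apply: eq_bigr => i _; rewrite /g subnKC// -ltnS.
have fT N : \sum_(n < N) \sum_(i < n.+1) f i (n - i)%N = KN al B om (r1 + r2) N x.
  apply: eq_bigr => n _; rewrite -risf_Vandermonde mulr_suml.
  by apply: eq_bigr => i _; rewrite /f subnKC// -ltnS.
have [M M0 hM] := wt_sum_bounded om x a0 b0 r0.
have cT : cvgn T.
  apply: nondecreasing_is_cvgn.
    move=> n m nm; rewrite /T -(subnKC nm) big_split_ord/= lerDl.
    by apply: sumr_ge0 => i _; rewrite mulr_ge0 ?risf_ge0 ?normc_ge0.
  by exists (M * rpw (Re B) x) => _ [N _ <-]; exact: hM.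
have cT2 : (fun N => T (N + N)%N - T N) @ \oo --> (0 : R).
  rewrite -(subrr (limn T)); apply: cvgB => //.
  apply: (@cvg_comp _ _ _ (fun N => (N + N)%N) T _ \oo) => //.
  move=> A [n _ nA]; exists n => // m /= nm; apply: nA => /=.
  exact: leq_trans nm (leq_addr _ _).
apply: (@squeeze_cvgr _ _ _ _ (fun=> 0) (fun N => T (N + N)%N - T N)) => //.
  apply: nearW => N; rewrite normc_ge0/= -fT -!gT.
  exact: square_sub_triangle_le.
exact: cvg_cst.
Qed.

(** The convolutions of partial sums are dominated by a multiple of the Beta integrand, integrable
    for every [x]. They converge to the left side, and as square sums they have the same limit as
    the partial sums of the right side. *)
Lemma conv_Ker al B1 B2 om r1 r2 x : 0 < Re al -> 0 < Re B1 -> 0 < Re B2 ->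
  conv (Ker al B1 om r1) (Ker al B2 om r2) x = Ker al (B1 + B2) om (r1 + r2) x.
Proof.
move=> a0 b1 b2; have [x0|x0] := ltP 0 x; last first.
  rewrite Ker_le0// /conv -[RHS](cint0 R); apply: eq_cint => t.
  have [t0|t0] := leP t 0; first by rewrite [Ker _ B2 _ _ _]Ker_le0// mulr0.
  by rewrite Ker_le0 ?mul0r// subr_le0 (le_trans x0)// ltW.
have b12 : 0 < Re (B1 + B2) by rewrite ReD addr_gt0.
have [M1 M10 hM1] := KN_le om r1 x a0 b1.
have [M2 M20 hM2] := KN_le om r2 x a0 b2.
pose F N t := KN al B1 om r1 N (x - t) * KN al B2 om r2 N t.
have mF N : cmeas (F N).
  apply: cmeasurableM; last exact: cmeasurable_KN.
  exact: (cmeasurable_comp (cmeasurable_KN _ _ _ _ _) (measurable_subl x)).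
have cF t : (fun N => Re (F N t)) @ \oo -->
      Re (Ker al B1 om r1 (x - t) * Ker al B2 om r2 t) /\
    (fun N => Im (F N t)) @ \oo --> Im (Ker al B1 om r1 (x - t) * Ker al B2 om r2 t).
  have [c1 c2] := KN_cvg om r1 (x - t) a0 b1; have [d1 d2] := KN_cvg om r2 t a0 b2.
  exact: (ccvgM c1 c2 d1 d2).
pose G t := M1 * M2 * nc (pw B1 (x - t) * pw B2 t).
have G0 t : 0 <= G t by rewrite mulr_ge0 ?normc_ge0// mulr_ge0.
have FG N t : nc (F N t) <= G t.
  have [t0|t0] := leP t 0.
    by rewrite /F [KN _ B2 _ _ _ _]KN_le0// mulr0 Normc.normc0.
  have [xt|xt] := leP x t.
    by rewrite /F [KN _ B1 _ _ _ _]KN_le0 ?subr_le0// mul0r Normc.normc0.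
  rewrite /F /G !Normc.normcM !normc_pw.
  rewrite [leRHS](_ : _ = M1 * rpw (Re B1) (x - t) * (M2 * rpw (Re B2) t)); last by ring.
  rewrite ler_pM ?normc_ge0//.
    by apply: hM1; rewrite gerBl ltW.
  by apply: hM2; rewrite ltW.
have iG : mu.-integrable setT (EFin \o G).
  exact: (integrableZl measurableT (M1 * M2) (integrable_normc (beta_integr x b1 b2))).
have [cR cI] := cint_cvg mF (fun t => (cF t).1) (fun t => (cF t).2) iG FG.
have SE N : cint setT (F N) = \sum_(i < N) \sum_(j < N)
    risf r1 i * risf r2 j * wt al (B1 + B2) om (i + j) x.
  exact: conv_KN.
have := KN_square_cvg om r1 r2 a0 b12 x0.
have [kR kI] := KN_cvg om (r1 + r2) x a0 b12.
under eq_fun do rewrite -SE.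
have small (p : C -> R) : (forall z, `|p z| <= nc z) ->
    (fun N => nc (cint setT (F N) - KN al (B1 + B2) om (r1 + r2) N x)) @ \oo --> (0 : R) ->
    (fun N => p (cint setT (F N) - KN al (B1 + B2) om (r1 + r2) N x)) @ \oo --> (0 : R).
  move=> hp c0; apply/norm_cvg0P.
  apply: (@squeeze_cvgr _ _ _ _ (fun=> 0)
    (fun N => nc (cint setT (F N) - KN al (B1 + B2) om (r1 + r2) N x))) => //.
    by apply: nearW => N; rewrite normr_ge0 hp.
  exact: cvg_cst.
move=> c0; apply: complex_eq; apply/eqP; rewrite -subr_eq0; apply/eqP.
  have := small _ (@ler_Re_normc R) c0; apply: cvg_unique => //.
  apply: (cvg_eqr _ erefl (cvgB cR kR)) => N; exact: ReB.
have := small _ (@ler_Im_normc R) c0; apply: cvg_unique => //.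
apply: (cvg_eqr _ erefl (cvgB cI kI)) => N; exact: ImB.
Qed.

Lemma Ker10 al om s : 0 < s -> Ker al 1 om 0 s = 1.
Proof.
move=> s0; rewrite /Ker /pw s0 subrr cpow0 mul1r.
have e z N : ML_partial al 1 0 z N.+1 = 1.
  rewrite /ML_partial big_ord_recl/= big1 ?addr0.
    by rewrite /pochhammer big_ord0 expr0 mulr0 add0r Gamma1 fact0 !mulr1 divr1.
  by move=> i _; rewrite /pochhammer big_ord_recl/= add0r !mul0r.
(* The empty partial sum is 0, so the sequence is constant only from index 1 on. *)
apply: complex_eq => /=; apply: cvg_lim => //; rewrite -(cvg_shiftS _).
  by apply: (cvg_eqr _ _ (cvg_cst (1 : R))) => // N; rewrite /= e.
by apply: (cvg_eqr _ _ (cvg_cst (0 : R))) => // N; rewrite /= e.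
Qed.

End KernelConvolution.

(** * Test functions on ]c, d[ *)

Section TestFunctions.
Variable R : realType.
Local Notation mu := (@lebesgue_measure R).
Variables (c d : R) (phi : R -> R).
Hypothesis tphi : test_fun c d phi.

Lemma test_fun_derivable n x : derivable (derive1n n phi) x 1.
Proof. by case: tphi. Qed.

Lemma test_fun_continuous n : continuous (derive1n n phi).
Proof.
move=> x; apply: differentiable_continuous; apply/derivable1_diffP.
exact: test_fun_derivable.
Qed.

Lemma test_fun_endpoint n : derive1n n phi d = 0.
Proof.
have [_ [a [b [ca ab bd phi0]]]] := tphi.
suff : forall x, b < x -> derive1n n phi x = 0 by apply.
elim: n => [|n ih] x bx; first by apply: phi0; right.
rewrite derive1nS derive1E (@near_eq_derive _ _ _ _ (cst 0)) ?derive_cst//.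
near=> y; apply: ih; near: y; exact: lt_nbhsr.
Unshelve. all: by end_near. Qed.

Lemma test_fun_bounded n : c < d ->
  exists2 M, 0 <= M & forall x, c < x < d -> `|derive1n n phi x| <= M.
Proof.
move=> cd.
have [y _ ymax] : exists2 y, y \in `[c, d]%R &
    forall t, t \in `[c, d]%R -> `|derive1n n phi t| <= `|derive1n n phi y|.
  apply: EVT_max; first exact: ltW.
  apply: continuous_subspaceT => t; apply: cvg_norm; exact: test_fun_continuous.
exists `|derive1n n phi y| => // x /andP[cx xd]; apply: ymax.
by rewrite in_itv/= !ltW.
Qed.

Lemma test_fun_FTC n x : x < d ->
  Rintegral mu `]x, d[ (derive1n n.+1 phi) = - derive1n n phi x.
Proof.
move=> xd; rewrite /Rintegral.
rewrite -(integral_itv_bndoo true false); last first.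
  apply/measurable_EFinP; apply: measurable_funTS.
  exact: continuous_measurable_fun (@test_fun_continuous n.+1).
rewrite (@continuous_FTC2 _ _ (derive1n n phi))//.
- by rewrite test_fun_endpoint -EFinB sub0r.
- by apply: continuous_subspaceT; exact: test_fun_continuous.
- split.
  + by move=> y _; exact: test_fun_derivable.
  + by apply: cvg_at_right_filter; exact: test_fun_continuous.
  + by apply: cvg_at_left_filter; exact: test_fun_continuous.
Qed.

End TestFunctions.

(** * Semigroup law almost everywhere and integration by parts *)

Section Semigroup.
Variable R : realType.
Local Notation C := R[i].
Local Notation RR := (measurableTypeR R).
Local Notation mu := (@lebesgue_measure R).
Local Notation integr := (cintegr mu).
Local Notation integr2 := (cintegr (mu \x mu)%E).
Local Notation cmeas := (@cmeasurable _ RR R).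
Variables (al om : C) (c d : R).
Hypotheses (al0 : 0 < Re al) (cd : c < d).
Implicit Types (B r : C) (f g h : R -> C).

(* Only arguments below [d - c] occur on ]c, d[; cutting the kernel off there makes
   it integrable on the line. *)
Definition KL B r (s : R) : C := if s < d - c then Ker al B om r s else 0.
Definition res f (t : R) : C := if c < t < d then f t else 0.

Lemma KL_le0 B r s : s <= 0 -> KL B r s = 0.
Proof. by move=> s0; rewrite /KL; case: ifP => // _; exact: Ker_le0. Qed.

Lemma KL_integr B r : 0 < Re B -> integr (KL B r).
Proof.
move=> b0; have [M M0 hM] := Ker_le om r (d - c) al0 b0.
have one0 : 0 < Re (1 : C) by rewrite /= ltr01.
apply: (@cintegr_le _ RR R mu _ (fun s : R => M * nc (pw 1 (d - c - s) * pw B s))).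
- apply: cmeasurable_if; [|exact: cmeasurable_Ker|exact: cmeasurable_cst].
  by apply: measurable_fun_ltr; [exact: measurable_id|exact: measurable_cst].
- move=> s; rewrite /KL; case: ifPn => [sL|_]; last first.
    by rewrite Normc.normc0 mulr_ge0 ?normc_ge0.
  have -> : pw 1 (d - c - s) = 1 by rewrite /pw subr_gt0 sL subrr cpow0.
  by rewrite mul1r (normc_pw B); apply: hM; exact: ltW.
- exact: (integrableZl measurableT M (integrable_normc (beta_integr (d - c) one0 b0))).
Qed.

Lemma prab_conv B r g x : c < x < d ->
  prab al B om r c g x = conv (KL B r) (res g) x.
Proof.
move=> /andP[cx xd]; rewrite /prab cint_mkcond convE; apply: eq_cint => t.
rewrite /res in_itv/=; have [ct|tc] := ltP c t; last by rewrite /= mulr0.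
have [tx|xt] /= := ltP t x; last by rewrite KL_le0 ?mul0r// subr_le0.
rewrite (lt_trans tx xd) /KL.
have -> : x - t < d - c by rewrite ltrB.
by rewrite /Ker /pw subr_gt0 tx.
Qed.

Lemma conv_KL_outside B r g t : t <= c -> conv (KL B r) (res g) t = 0.
Proof.
move=> tc; rewrite convE -[RHS](cint0 R); apply: eq_cint => s.
rewrite /res; case: ifPn; rewrite ?mulr0// => /andP[cs _].
by rewrite KL_le0 ?mul0r// subr_le0 (le_trans tc)// ltW.
Qed.

Fact KLconv_key : unit. Proof. by []. Qed.

(* Locked because unification otherwise unfolds the kernel down to its defining
   series when it compares two values of the parameters. *)
Definition KLconv B r f : R -> C := locked_with KLconv_key (conv (KL B r) (res f)).

Lemma KLconvE B r f : KLconv B r f = conv (KL B r) (res f).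
Proof. by rewrite /KLconv unlock. Qed.

(** The inner operator matches the convolution on ]c, d[ only. To the left of c the truncation by
    [res] and the convolution both vanish; to the right of d the outer kernel has a negative
    argument. *)
Lemma prab_prab_conv B1 r1 B2 r2 f x : c < x < d ->
  prab al B1 om r1 c (prab al B2 om r2 c f) x =
  conv (KL B1 r1) (KLconv B2 r2 f) x.
Proof.
move=> cxd; rewrite prab_conv//; move: cxd => /andP[cx xd].
rewrite convE [RHS]convE; apply: eq_cint => t; rewrite {1}/res KLconvE.
have [ct|tc] /= := ltP c t; last by rewrite conv_KL_outside.
have [td|dt] := ltP t d; first by rewrite prab_conv// ct td.
by rewrite KL_le0 ?mul0r// subr_le0 ltW// (lt_le_trans xd).
Qed.

(** At [u] both kernels are evaluated between 0 and [u] only, so the cut at [d - c] is not felt. *)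
Lemma conv_KL B1 r1 B2 r2 u : 0 < Re B1 -> 0 < Re B2 -> u < d - c ->
  conv (KL B1 r1) (KL B2 r2) u = KL (B1 + B2) (r1 + r2) u.
Proof.
move=> b1 b2 uL; rewrite [RHS]/KL uL -conv_Ker// !convE; apply: eq_cint => t.
have [t0|t0] := leP t 0; first by rewrite (KL_le0 B2)// (Ker_le0 al B2)// !mulr0.
have [ut|tu] := leP u t.
  by rewrite (KL_le0 B1) ?(Ker_le0 al B1) ?subr_le0// !mul0r.
by rewrite /KL (lt_trans tu uL) (le_lt_trans _ uL)// gerBl ltW.
Qed.

Lemma conv_KL_ae B1 r1 B2 r2 f : 0 < Re B1 -> 0 < Re B2 -> integr (res f) ->
  {ae mu, forall x : RR, c < x < d ->
    conv (KL B1 r1) (KLconv B2 r2 f) x = KLconv (B1 + B2) (r1 + r2) f x}.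
Proof.
move=> b1 b2 fi.
have := convA fi (KL_integr r1 b1) (KL_integr r2 b2).
move/ae_imp; apply => x E /andP[cx xd].
transitivity (conv (conv (KL B1 r1) (KL B2 r2)) (res f) x); first by rewrite KLconvE.
rewrite KLconvE convE [RHS]convE; apply: eq_cint => s.
rewrite /res; case: ifPn; rewrite ?mulr0// => /andP[cs sd].
by rewrite conv_KL// ltrB.
Qed.

(** The distribution on ]c, d[ given by [h], written over the whole line to suit Fubini. *)
Definition pairing h (psi : R -> R) : C := locked_with KLconv_key
  (cint setT (fun x => if c < x < d then h x * (psi x)%:C else 0)).

Lemma pairingE h psi :
  pairing h psi = cint setT (fun x => if c < x < d then h x * (psi x)%:C else 0).
Proof. by rewrite /pairing unlock. Qed.

Lemma measurable_in_itv (a b : R) : measurable_fun setT (fun x : RR => (a < x < b)%R).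
Proof.
by apply: measurable_and; apply: measurable_fun_ltr;
  solve [exact: measurable_id|exact: measurable_cst].
Qed.

Lemma cmeasurable_pairing h (psi : R -> R) : cmeas h -> measurable_fun setT psi ->
  cmeas (fun x => if c < x < d then h x * (psi x)%:C else 0).
Proof.
move=> mh mpsi; apply: cmeasurable_if; [exact: measurable_in_itv| |exact: cmeasurable_cst].
by apply: cmeasurableM; [exact: mh|exact: (@cmeasurable_real _ RR)].
Qed.

Lemma ae_eq_pairing g h (psi : R -> R) : cmeas g -> cmeas h -> measurable_fun setT psi ->
  {ae mu, forall x : RR, c < x < d -> g x = h x} -> pairing g psi = pairing h psi.
Proof.
move=> mg mh mpsi gh; rewrite !pairingE; apply: ae_eq_cint.
- exact: cmeasurable_pairing.
- exact: cmeasurable_pairing.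
- by apply: (ae_imp gh) => x ghx; case: ifPn => // /ghx ->.
Qed.

Lemma KLconv_integr B r f : 0 < Re B -> integr (res f) -> integr (KLconv B r f).
Proof. by move=> b0 fi; rewrite KLconvE; apply: conv_integr => //; exact: KL_integr. Qed.

Lemma cint_prab B r g (psi : R -> R) :
  cint `]c, d[ (fun x => prab al B om r c g x * (psi x)%:C) =
  pairing (KLconv B r g) psi.
Proof.
rewrite [LHS]cint_mkcond pairingE; apply: eq_cint => x; rewrite in_itv/=; case: ifPn => // cxd.
by rewrite prab_conv// KLconvE.
Qed.

Lemma cint_prab_prab B1 r1 B2 r2 f (psi : R -> R) : 0 < Re B1 -> 0 < Re B2 ->
  integr (res f) -> measurable_fun setT psi ->
  cint `]c, d[ (fun x => prab al B1 om r1 c (prab al B2 om r2 c f) x * (psi x)%:C) =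
  pairing (KLconv (B1 + B2) (r1 + r2) f) psi.
Proof.
move=> b1 b2 fi mpsi.
transitivity (pairing (conv (KL B1 r1) (KLconv B2 r2 f)) psi).
  rewrite [LHS]cint_mkcond pairingE; apply: eq_cint => x; rewrite in_itv/=; case: ifPn => // cxd.
  by rewrite prab_prab_conv.
apply: ae_eq_pairing => //.
- by apply: cintegr_meas; apply: conv_integr; [exact: KL_integr|exact: KLconv_integr].
- by apply: cintegr_meas; apply: KLconv_integr => //; rewrite ReD addr_gt0.
- exact: conv_KL_ae.
Qed.

(** Against K_{1,0} the integral runs from [x] to [d], where every derivative of [phi] vanishes;
    hence the minus sign. *)
Lemma cint_KL10 phi n x : test_fun c d phi -> c < x ->
  cint setT (fun y => (if c < y < d then (derive1n n.+1 phi y)%:C else 0) * KL 1 0 (y - x))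
  = if x < d then - (derive1n n phi x)%:C else 0.
Proof.
move=> tphi cx.
have e y : (if c < y < d then (derive1n n.+1 phi y)%:C else 0) * KL 1 0 (y - x) =
    if x < y < d then (derive1n n.+1 phi y)%:C else 0 :> C.
  have [xy|yx] /= := ltP x y; last first.
    by rewrite KL_le0 ?subr_le0// mulr0.
  rewrite (lt_trans cx xy)/=; case: ifP => yd; last by rewrite mul0r.
  by rewrite /KL ltrB// Ker10 ?subr_gt0// mulr1.
transitivity (cint `]x, d[%classic (fun y => (derive1n n.+1 phi y)%:C)).
  by rewrite cint_mkcond; apply: eq_cint => y; rewrite e in_itv.
case: ifPn => [xd|].
  rewrite /cint; apply: complex_eq => /=; first by rewrite (test_fun_FTC tphi).
  by rewrite /Rintegral integral0 oppr0.
rewrite -leNgt => dx; rewrite set_itv_ge ?bnd_simp -?leNgt//.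
by rewrite /cint !Rintegral_set0.
Qed.

(** Fubini transposes the convolution onto [psi], whose boundedness on ]c, d[ makes the double
    integral absolutely convergent. *)
Lemma pairing_conv (K h : R -> C) (psi : R -> R) (M : R) :
  integr K -> integr h -> measurable_fun setT psi ->
  0 <= M -> (forall x, c < x < d -> `|psi x| <= M) ->
  pairing (conv K h) psi = cint setT (fun x =>
    cint setT (fun y => (if c < y < d then (psi y)%:C else 0) * K (y - x)) * h x).
Proof.
move=> iK ih mpsi M0 hM.
have mK := cintegr_meas iK; have mh := cintegr_meas ih.
pose P y : C := if c < y < d then (psi y)%:C else 0.
have mP : cmeas P.
  apply: cmeasurable_if; [exact: measurable_in_itv| |exact: cmeasurable_cst].
  exact: (@cmeasurable_real _ RR R _ mpsi).
have PM y : nc (P y) <= M.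
  rewrite /P; case: ifPn => [|_]; last by rewrite Normc.normc0.
  by rewrite normc_real => /hM.
have i2 : integr2 (fun z => P z.1 * (K (z.1 - z.2) * h z.2)).
  have ic := conv_integr2 iK ih.
  apply: (@cintegr_le _ _ R (mu \x mu)%E _
     (fun z : RR * RR => M * nc (K (z.1 - z.2) * h z.2))).
  - apply: cmeasurableM; first exact: (cmeasurable_comp mP measurable_fst).
    exact: cintegr_meas ic.
  - by move=> z; rewrite Normc.normcM ler_wpM2r ?normc_ge0.
  - exact: (integrableZl measurableT M (integrable_normc ic)).
have [j1 j2 jE] := cfubini i2.
transitivity (cint setT (fun y => cint setT (fun x => P y * (K (y - x) * h x)))).
  rewrite pairingE; apply: ae_eq_cint.
  - apply: cmeasurable_pairing; last exact: mpsi.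
    exact: cintegr_meas (conv_integr iK ih).
  - exact: cintegr_meas j1.
  - apply: (ae_imp (cfubini_ae1 i2)) => y /= iy.
    rewrite (cintZ' iy) /P convE.
    by case: ifPn => _; [rewrite mulrC|rewrite mul0r].
rewrite [LHS]jE; apply: eq_cint => x; rewrite -[in RHS]/(P _).
have e y : P y * (K (y - x) * h x) = P y * K (y - x) * h x by rewrite mulrA.
under eq_cint do rewrite /= e.
have iKx : integr (fun y => P y * K (y - x)).
  apply: (@cintegr_le _ RR R mu _ (fun y : R => M * nc (K (y - x)))).
  - apply: cmeasurableM; first exact: mP.
    exact: (cmeasurable_comp mK (measurable_subr x)).
  - by move=> y; rewrite Normc.normcM ler_wpM2r ?normc_ge0.
  - have := cintegr_affine (- x) ltr01 iK.
    under eq_fun do rewrite mul1r.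
    by move/integrable_normc/(integrableZl measurableT M).
transitivity (h x * cint setT (fun y => P y * K (y - x))); last exact: mulrC.
by rewrite -(cintZ (h x) iKx); apply: eq_cint => y; exact: mulrC.
Qed.

(** [KLconv B r f] is merely integrable, so the identity does not come from differentiating:
    [KLconv (B + 1) r f] is almost everywhere its convolution with K_{1,0}, and this convolution is
    transposed onto the test function. *)
Lemma pairing_by_parts B r f phi n : 0 < Re B -> integr (res f) -> test_fun c d phi ->
  pairing (KLconv (B + 1) r f) (derive1n n.+1 phi) =
  - pairing (KLconv B r f) (derive1n n phi).
Proof.
move=> b0 fi tphi; have one0 : 0 < Re (1 : C) by rewrite /= ltr01.
have ih : integr (KLconv B r f) by exact: KLconv_integr.
have iK : integr (KL 1 0) by exact: KL_integr.
have mpsi m : measurable_fun setT (derive1n m phi).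
  exact: continuous_measurable_fun (@test_fun_continuous R c d phi tphi m).
transitivity (pairing (conv (KL 1 0) (KLconv B r f)) (derive1n n.+1 phi)).
  apply/esym/ae_eq_pairing.
  - exact: cintegr_meas (conv_integr iK ih).
  - by apply: cintegr_meas; apply: KLconv_integr => //; rewrite ReD addr_gt0.
  - exact: mpsi.
  - have e1 : 1 + B = B + 1 by rewrite addrC.
    have e2 : 0 + r = r by rewrite add0r.
    by have := conv_KL_ae 0 r one0 b0 fi; rewrite e1 e2 => E; exact: E.
have h0 x : x <= c -> KLconv B r f x = 0.
  by move=> xc; rewrite KLconvE conv_KL_outside.
move: (KLconv B r f) ih h0 => h ih h0.
have [M M0 hM] := test_fun_bounded tphi n.+1 cd.
have [M' M'0 hM'] := test_fun_bounded tphi n cd.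
rewrite (pairing_conv iK ih (mpsi n.+1) M0 hM) pairingE -mulN1r -cintZ.
  apply: eq_cint => x; have [cx|xc] /= := ltP c x; last by rewrite h0// !mulr0.
  rewrite cint_KL10//; case: ifP => _; last by rewrite mul0r mulr0.
  by rewrite mulN1r mulNr mulrC.
apply: (@cintegr_le _ RR R mu _ (fun x : R => M' * nc (h x))).
- by apply: cmeasurable_pairing; [exact: cintegr_meas ih|exact: mpsi].
- move=> x; case: ifPn => [|_]; last by rewrite Normc.normc0 mulr_ge0 ?normc_ge0.
  by move=> /hM' hx; rewrite Normc.normcM normc_real mulrC ler_wpM2r ?normc_ge0.
- exact: (integrableZl measurableT M' (integrable_normc ih)).
Qed.

Lemma pairing_iter_by_parts B r f phi n k : 0 < Re B -> integr (res f) -> test_fun c d phi ->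
  pairing (KLconv (B + k%:R) r f) (derive1n (n + k) phi) =
  (-1) ^+ k * pairing (KLconv B r f) (derive1n n phi).
Proof.
move=> b0 fi tphi; elim: k => [|k ih]; first by rewrite addr0 addn0 mul1r.
have bk : 0 < Re (B + k%:R) by rewrite ReD Re_nat ltr_wpDr.
have -> : B + k.+1%:R = B + k%:R + 1 by rewrite -natr1 addrA.
rewrite [(n + k.+1)%N]addnS.
transitivity (- pairing (KLconv (B + k%:R) r f) (derive1n (n + k) phi)).
  exact: pairing_by_parts.
have E p : - ((-1) ^+ k * p) = (-1) ^+ k.+1 * p :> C by rewrite exprS mulN1r mulNr.
exact: (etrans (congr1 (fun z => - z) ih) (E _)).
Qed.

End Semigroup.

(** * Number of derivatives in the iterated operator *)

Section IterOrder.
Variable R : realType.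
Implicit Types z : R[i].

Lemma iter_orderE z : (Defs.iter_order z)%:Z = Num.max 0 (Num.floor (Re (- z)) + 1).
Proof. by rewrite /Defs.iter_order gez0_abs// le_max lexx. Qed.

(** Ensures that the kernel left after extracting the derivatives is integrable at 0; strict because
    floor(t) + 1 > t. *)
Lemma iter_order_gt z : 0 < Re ((Defs.iter_order z)%:R + z).
Proof.
rewrite ReD Re_nat -ltrBlDr sub0r -ReN (lt_le_trans (floorD1_gt _))//.
by rewrite -[leRHS]/((Defs.iter_order z)%:Z%:~R) ler_int iter_orderE le_max lexx orbT.
Qed.

Lemma iter_order_le z1 z2 : Re z1 <= Re z2 -> (Defs.iter_order z2 <= Defs.iter_order z1)%N.
Proof.
move=> z12; rewrite -lez_nat !iter_orderE ge_max le_max lexx/= le_max.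
by apply/orP; right; rewrite lerD2r le_floor// !ReN lerN2.
Qed.

End IterOrder.

Theorem theorem5p3 (R : realType) (al be om rho : R[i]) (c d : R)
    (f : R -> R[i]) (mu nu : R[i]) :
  0 < complex.Re al -> 0 < complex.Re be -> c < d ->
  cintegrable `]c, d[ f ->
  0 < complex.Re (nu * be) ->
  forall phi : R -> R, test_fun c d phi ->
    prab_iter al be om rho c d mu (prab al (nu * be) om (nu * rho) c f) phi
    = prab_iter al be om rho c d (mu + nu) f phi.
Proof.
move=> al0 be0 cd fi nube0 phi tphi; rewrite /prab_iter.
have resfi : cintegr (@lebesgue_measure R) (res c d f).
  rewrite (_ : res c d f = fun t => if t \in Interval (BRight c) (BLeft d) then f t else 0).
    exact: cintegrable_mkcond fi.
  by apply/funext => t; rewrite /res in_itv.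
have := iter_order_gt (mu * be); have := iter_order_gt ((mu + nu) * be).
(* Re(nu * be) > 0 can only lower the order; the difference [k] counts the surplus derivatives on
   the left side. *)
have : (Defs.iter_order ((mu + nu) * be)%R <= Defs.iter_order (mu * be)%R)%N.
  by apply: iter_order_le; rewrite mulrDl ReD lerDl ltW.
move: (Defs.iter_order ((mu + nu) * be)) (Defs.iter_order (mu * be)) => m m' mm' B3 B1.
have [k m'E] : exists k, m' = (m + k)%N by exists (m' - m)%N; rewrite subnKC.
subst m'.
have mphi n : measurable_fun setT (derive1n n phi).
  exact: continuous_measurable_fun (test_fun_continuous tphi (n := n)).
transitivity ((-1) ^+ (m + k) * pairing c d
    (KLconv al om c d ((m + k)%:R + mu * be + nu * be) (mu * rho + nu * rho) f)
    (derive1n (m + k) phi)).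
  congr (_ * _); exact: cint_prab_prab.
transitivity ((-1) ^+ m * pairing c d
    (KLconv al om c d (m%:R + (mu + nu) * be) ((mu + nu) * rho) f) (derive1n m phi)).
  (* The kernel exponent on the left exceeds that on the right by exactly [k], the number of
     integrations by parts to perform. *)
  have -> : (m + k)%:R + mu * be + nu * be = m%:R + (mu + nu) * be + k%:R.
    by rewrite natrD; ring.
  have -> : mu * rho + nu * rho = (mu + nu) * rho by rewrite mulrDl.
  have E := pairing_iter_by_parts om al0 cd ((mu + nu) * rho) m k B3 resfi tphi.
  have sgn p : (-1) ^+ (m + k) * ((-1) ^+ k * p) = (-1) ^+ m * p :> R[i].
    by rewrite mulrA -exprD -addnA addnn exprD -muln2 exprM sqrr_sign mulr1.
  exact: (etrans (congr1 (fun z => (-1) ^+ (m + k) * z) E) (sgn _)).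
congr (_ * _); apply: esym; exact: cint_prab.
Qed.
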